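(* Let $M^5$ have coordinates $(z,\theta,\phi,x,q)$ with $\sin\theta\neq0$, $\sin x\ne0$, and for a real constant $\alpha$ consider the rank 3 Pfaffian system on $M^5$ spanned by $$\eta_1=\sigma_2+i\sigma_1+\alpha(dx-i \sin(x)\, dq),\qquad \eta_2=\bar\eta_1=\sigma_2-i\sigma_1+\alpha(dx+i \sin(x)\, dq),$$ $$\eta_3=-dz-\cos(\theta)\, d\phi+\cos(x)\, dq,$$ where $\sigma_1=\sin z\,d\theta-\cos z\sin\theta\,d\phi$ and $\sigma_2=\cos z\,d\theta+\sin z\sin\theta\,d\phi$. Let $$\tau_1=e^{iz}(d\theta-i\sin\theta\, d\phi),\quad \tau_2=e^{-iz}(d\theta+i\sin\theta\, d\phi),\quad \tau_4=e^{iz}(dx-i\sin x\, dq),\quad \tau_5=e^{-iz}(dx+i\sin x\, dq).$$ The $(2,3,5)$-distribution associated to this Pfaffian system (the kernel of $\eta_1,\eta_2,\eta_3$) is maximally symmetric when $\alpha^2=\frac19$ or $\alpha^2=9$, i.e. when $\alpha=\pm\frac13$ or $\alpha=\pm3$. When $\alpha=\pm\frac13$, a representative metric in Nurowski's conformal structure associated to this distribution is $$g=9 \eta_1\eta_2+3\eta_3\eta_3-18\tau_1\tau_2+2\tau_4\tau_5 .$$ When $\alpha=\pm 3$, a representative metric in Nurowski's conformal structure associated to this distribution is $$g=\eta_1\eta_2+3\eta_3\eta_3+2\tau_1\tau_2-18\tau_4\tau_5 .$$ The two metrics are equivalent via the substitution $(z,\theta,\phi,x,q)\mapsto(-z,x,q,\theta,\phi)$.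 Both are conformally flat with vanishing Weyl tensor. Under a conformal rescaling, the first (resp. second) metric $$\hat g=\frac{4}{\cos(\theta)^2}\,g\qquad\left(\text{resp. } \hat g=\frac{4}{\cos(x)^2}\,g\right),$$ on the set where $\cos\theta\ne0$ (resp. $\cos x\neq0$), is Einstein with $\mathrm{Ric}(\hat g)=\frac{1}{12}\hat g$ (resp. $\mathrm{Ric}(\hat g)=\frac{1}{12}\hat g$).
   Context: Products of 1-forms are symmetric products. (In the source, $M^5$ arises as the submanifold $\{z=v=\psi\}$ of $S^3\times S^3\times\mathbb{R}$ with coordinates $(\psi,\theta,\phi,v,x,q,z)$, where $(\psi,\theta,\phi)$ and $(v,x,q)$ are Euler angles on the two copies of $S^3\cong SU(2)$; the forms in the statement are the restrictions to $M^5$.) The metrics displayed are real, since $\eta_2=\bar\eta_1$, $\tau_2=\bar\tau_1$, $\tau_5=\bar\tau_4$. In the equivalence of the two metrics, the $\alpha=\frac13$ metric corresponds to the $\alpha=3$ one and $\alpha=-\frac13$ to $\alpha=-3$. $\mathrm{Ric}$ is the Ricci tensor, with the sign convention in which round spheres have positive Ricci curvature. A $(2,3,5)$-distribution on a 5-manifold $M$ is a rank 2 distribution $D\subset TM$ with $[D,D]$ of rank 3 and $[[D,D],D]=TM$. Nurowski's conformal class of $D$: locally there exist a coframe $(\theta_1,\dots,\theta_5)$ with $D=\ker(\theta_1,\theta_2,\theta_3)$ and 1-forms $\Omega_1,\dots,\Omega_7$ satisfying Cartan's structure equations $$d\theta_1=\theta_1\wedge(2\Omega_1+\Omega_4)+\theta_2\wedge\Omega_2+\theta_3\wedge\theta_4,$$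 $$d\theta_2=\theta_1\wedge\Omega_3+\theta_2\wedge(\Omega_1+2\Omega_4)+\theta_3\wedge\theta_5,$$ $$d\theta_3=\theta_1\wedge\Omega_5+\theta_2\wedge\Omega_6+\theta_3\wedge(\Omega_1+\Omega_4)+\theta_4\wedge\theta_5,$$ $$d\theta_4=\theta_1\wedge\Omega_7+\tfrac43\theta_3\wedge\Omega_6+\theta_4\wedge\Omega_1+\theta_5\wedge\Omega_2,$$ $$d\theta_5=\theta_2\wedge\Omega_7-\tfrac43\theta_3\wedge\Omega_5+\theta_4\wedge\Omega_3+\theta_5\wedge\Omega_4,$$ and the class is that of $g=2\theta_1\theta_5-2\theta_2\theta_4+\frac43\theta_3\theta_3$ (signature $(2,3)$), which depends only on $D$ up to conformal rescaling (rescaling by a nonzero function of either sign is allowed). $D$ is called maximally symmetric when $g$ has vanishing Weyl tensor; its local infinitesimal symmetries then form the split real form of $\mathfrak{g}_2$. *)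

(* Defs.v *)
From HB Require Import structures.
From mathcomp Require Import all_boot all_order all_algebra complex.
From mathcomp Require Import all_classical all_reals all_analysis.

Set Implicit Arguments.
Unset Strict Implicit.
Unset Printing Implicit Defensive.

Import Order.TTheory GRing.Theory Num.Theory.
Import numFieldNormedType.Exports.

Local Open Scope classical_set_scope.
Local Open Scope ring_scope.

(* Tensor calculus in the coordinates of an open subset of R^n.  Vector fields
   and 1-forms are both maps 'rV_n -> 'rV_n (their components); bilinear forms
   on tangent spaces, in particular 2-forms and metrics, are square matrices. *)

Definition partial {R : realType} {n : nat} (i : 'I_n)
    (f : 'rV[R]_n -> R) (p : 'rV[R]_n) : R :=
  'D_(delta_mx 0 i) f p.

Fixpoint Ck_on {R : realType} {n : nat} (k : nat) (U : set 'rV[R]_n)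
    (f : 'rV[R]_n -> R) : Prop :=
  if k is k'.+1 then
    (forall p, U p -> differentiable f p) /\
    (forall i, Ck_on k' U (partial i f))
  else forall p, U p -> {for p, continuous f}.

Definition smooth_on {R : realType} {n : nat} (U : set 'rV[R]_n)
    (f : 'rV[R]_n -> R) : Prop :=
  forall k, Ck_on k U f.

Definition smooth_mx_on {R : realType} {n m l : nat} (U : set 'rV[R]_n)
    (F : 'rV[R]_n -> 'M[R]_(m, l)) : Prop :=
  forall i j, smooth_on U (fun p => F p i j).

Definition open_nbhd_in {R : realType} {n : nat} (U : set 'rV[R]_n)
    (p : 'rV[R]_n) (V : set 'rV[R]_n) : Prop :=
  [/\ open V, V p & V `<=` U].

(* The wedge product and the exterior derivative carry no factor 1/2:
   (a /\ b)(X, Y) = a(X) b(Y) - a(Y) b(X) and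
   dw(X, Y) = X(w(Y)) - Y(w(X)) - w([X, Y]). *)
Definition wedge {K : fieldType} {n : nat} (a b : 'rV[K]_n) : 'M[K]_n :=
  a^T *m b - b^T *m a.

Definition ext_deriv {R : realType} {n : nat} (w : 'rV[R]_n -> 'rV[R]_n)
    (p : 'rV[R]_n) : 'M[R]_n :=
  \matrix_(i, j) (partial i (fun q => w q 0 j) p -
                  partial j (fun q => w q 0 i) p).

(* Normalized so that the symmetric product a a is a (x) a. *)
Definition symprod {K : fieldType} {n : nat} (a b : 'rV[K]_n) : 'M[K]_n :=
  2^-1 *: (a^T *m b + b^T *m a).

Definition lie_bracket {R : realType} {n : nat} (X Y : 'rV[R]_n -> 'rV[R]_n)
    (p : 'rV[R]_n) : 'rV[R]_n :=
  \row_k \sum_i (X p 0 i * partial i (fun q => Y q 0 k) p -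
                 Y p 0 i * partial i (fun q => X q 0 k) p).

Definition lin_span {R : realType} {n : nat} (S : set 'rV[R]_n) :
    set 'rV[R]_n :=
  [set v | forall W : {vspace 'rV[R]_n}, (forall u, S u -> u \in W) -> v \in W].

Definition has_dim {R : realType} {n : nat} (S : set 'rV[R]_n) (k : nat) :
    Prop :=
  exists W : {vspace 'rV[R]_n}, \dim W = k /\ S = [set v | v \in W].

(* A smooth rank k distribution on U, given by its fibres D p. *)
Definition is_distribution {R : realType} {n : nat} (U : set 'rV[R]_n)
    (k : nat) (D : 'rV[R]_n -> set 'rV[R]_n) : Prop :=
  forall p, U p -> exists V, open_nbhd_in U p V /\
    exists X : 'I_k -> 'rV[R]_n -> 'rV[R]_n,
      (forall i, smooth_mx_on V (X i)) /\
      forall q, V q ->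
        let B := [tuple X i q | i < k] in
        free B /\ D q = [set v | v \in <<B>>%VS].

Definition is_section {R : realType} {n : nat} (V : set 'rV[R]_n)
    (D : 'rV[R]_n -> set 'rV[R]_n) (X : 'rV[R]_n -> 'rV[R]_n) : Prop :=
  smooth_mx_on V X /\ forall q, V q -> D q (X q).

(* The fibre at p of [D, E]. *)
Definition bracket_dist {R : realType} {n : nat} (U : set 'rV[R]_n)
    (D E : 'rV[R]_n -> set 'rV[R]_n) (p : 'rV[R]_n) : set 'rV[R]_n :=
  lin_span [set v | exists V X Y,
    [/\ open_nbhd_in U p V, is_section V D X, is_section V E Y
      & v = lie_bracket X Y p]].

Definition distribution235 {R : realType} (U : set 'rV[R]_5)
    (D : 'rV[R]_5 -> set 'rV[R]_5) : Prop :=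
  [/\ is_distribution U 2 D,
      forall p, U p -> has_dim (bracket_dist U D D p) 3
    & forall p, U p -> bracket_dist U (bracket_dist U D D) D p = setT].

(* Curvature of the Levi-Civita connection of g, with
   R(d_i, d_j) d_k = R^l_{kij} d_l and Ric_{kj} = R^i_{kij}, so that round
   spheres have positive Ricci curvature. *)

(* Gamma^k_{ij} *)
Definition christoffel {R : realType} {n : nat} (g : 'rV[R]_n -> 'M[R]_n)
    (k i j : 'I_n) (p : 'rV[R]_n) : R :=
  2^-1 * \sum_l invmx (g p) k l *
    (partial i (fun q => g q j l) p + partial j (fun q => g q i l) p -
     partial l (fun q => g q i j) p).

(* R^l_{kij} *)
Definition riemann {R : realType} {n : nat} (g : 'rV[R]_n -> 'M[R]_n)
    (l k i j : 'I_n) (p : 'rV[R]_n) : R :=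
  partial i (christoffel g l j k) p - partial j (christoffel g l i k) p +
  \sum_m (christoffel g l i m p * christoffel g m j k p -
          christoffel g l j m p * christoffel g m i k p).

Definition ricci {R : realType} {n : nat} (g : 'rV[R]_n -> 'M[R]_n)
    (p : 'rV[R]_n) : 'M[R]_n :=
  \matrix_(k, j) \sum_i riemann g i k i j p.

Definition scalar_curvature {R : realType} {n : nat}
    (g : 'rV[R]_n -> 'M[R]_n) (p : 'rV[R]_n) : R :=
  \sum_i \sum_j invmx (g p) i j * ricci g p i j.

(* W_{lkij}, all indices down; meaningful for n >= 3. *)
Definition weyl {R : realType} {n : nat} (g : 'rV[R]_n -> 'M[R]_n)
    (l k i j : 'I_n) (p : 'rV[R]_n) : R :=
  \sum_m g p l m * riemann g m k i j p
  - (n%:R - 2)^-1 * (g p i l * ricci g p j k - g p i k * ricci g p j l +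
                     g p j k * ricci g p i l - g p j l * ricci g p i k)
  + scalar_curvature g p / ((n%:R - 1) * (n%:R - 2)) *
    (g p i l * g p j k - g p i k * g p j l).

Definition weyl_vanishes {R : realType} {n : nat} (U : set 'rV[R]_n)
    (g : 'rV[R]_n -> 'M[R]_n) : Prop :=
  forall p, U p -> forall l k i j, weyl g l k i j p = 0.

Definition conformally_flat {R : realType} {n : nat} (U : set 'rV[R]_n)
    (g : 'rV[R]_n -> 'M[R]_n) : Prop :=
  forall p, U p -> exists V (f : 'rV[R]_n -> R),
    [/\ open_nbhd_in U p V, smooth_on V f, forall q, V q -> 0 < f q
      & forall q, V q -> forall l k i j,
          riemann (fun r => f r *: g r) l k i j q = 0].

(* 'J F p acts on row vectors: its (i, k) entry is the i-th partial derivative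
   of the k-th component of F. *)
Definition pullback {R : realType} {n : nat} (F : 'rV[R]_n -> 'rV[R]_n)
    (h : 'rV[R]_n -> 'M[R]_n) (p : 'rV[R]_n) : 'M[R]_n :=
  'J F p *m h (F p) *m ('J F p)^T.

Definition is_isometry {R : realType} {n : nat}
    (U : set 'rV[R]_n) (g : 'rV[R]_n -> 'M[R]_n)
    (V : set 'rV[R]_n) (h : 'rV[R]_n -> 'M[R]_n)
    (F : 'rV[R]_n -> 'rV[R]_n) : Prop :=
  (exists G : 'rV[R]_n -> 'rV[R]_n,
    [/\ smooth_mx_on U F, smooth_mx_on V G,
        forall p, U p -> V (F p) /\ G (F p) = p
      & forall q, V q -> U (G q) /\ F (G q) = q]) /\
  forall p, U p -> pullback F h p = g p.

(* Cartan's structure equations; t1, ..., t5 stand for theta_1, ..., theta_5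
   and o1, ..., o7 for Omega_1, ..., Omega_7. *)
Definition cartan_equations {R : realType} (V : set 'rV[R]_5)
    (t1 t2 t3 t4 t5 o1 o2 o3 o4 o5 o6 o7 : 'rV[R]_5 -> 'rV[R]_5) : Prop :=
  forall p, V p ->
  [/\ ext_deriv t1 p = wedge (t1 p) (2 *: o1 p + o4 p) + wedge (t2 p) (o2 p)
                       + wedge (t3 p) (t4 p),
      ext_deriv t2 p = wedge (t1 p) (o3 p) + wedge (t2 p) (o1 p + 2 *: o4 p)
                       + wedge (t3 p) (t5 p),
      ext_deriv t3 p = wedge (t1 p) (o5 p) + wedge (t2 p) (o6 p)
                       + wedge (t3 p) (o1 p + o4 p) + wedge (t4 p) (t5 p),
      ext_deriv t4 p = wedge (t1 p) (o7 p) + (4 / 3) *: wedge (t3 p) (o6 p)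
                       + wedge (t4 p) (o1 p) + wedge (t5 p) (o2 p)
    & ext_deriv t5 p = wedge (t2 p) (o7 p) - (4 / 3) *: wedge (t3 p) (o5 p)
                       + wedge (t4 p) (o3 p) + wedge (t5 p) (o4 p)].

Definition cartan_coframe {R : realType} (V : set 'rV[R]_5)
    (D : 'rV[R]_5 -> set 'rV[R]_5)
    (t1 t2 t3 t4 t5 : 'rV[R]_5 -> 'rV[R]_5) : Prop :=
  [/\ [/\ smooth_mx_on V t1, smooth_mx_on V t2, smooth_mx_on V t3,
          smooth_mx_on V t4 & smooth_mx_on V t5],
      forall p, V p -> free [:: t1 p; t2 p; t3 p; t4 p; t5 p],
      forall p, V p -> D p = [set v | [/\ t1 p *m v^T = 0, t2 p *m v^T = 0
                                        & t3 p *m v^T = 0]]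
    & exists o1 o2 o3 o4 o5 o6 o7 : 'rV[R]_5 -> 'rV[R]_5,
      [/\ [/\ smooth_mx_on V o1, smooth_mx_on V o2, smooth_mx_on V o3
            & smooth_mx_on V o4],
          [/\ smooth_mx_on V o5, smooth_mx_on V o6 & smooth_mx_on V o7]
        & cartan_equations V t1 t2 t3 t4 t5 o1 o2 o3 o4 o5 o6 o7]].

Definition nurowski_metric {R : realType}
    (t1 t2 t3 t4 t5 : 'rV[R]_5 -> 'rV[R]_5) (p : 'rV[R]_5) : 'M[R]_5 :=
  2 *: symprod (t1 p) (t5 p) - 2 *: symprod (t2 p) (t4 p)
  + (4 / 3) *: symprod (t3 p) (t3 p).

(* g is a representative, on U, of Nurowski's conformal class of D; the
   conformal factor may have either sign. *)
Definition in_nurowski_class {R : realType} (U : set 'rV[R]_5)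
    (D : 'rV[R]_5 -> set 'rV[R]_5) (g : 'rV[R]_5 -> 'M[R]_5) : Prop :=
  forall p, U p -> exists V, open_nbhd_in U p V /\
    exists (t1 t2 t3 t4 t5 : 'rV[R]_5 -> 'rV[R]_5) (f : 'rV[R]_5 -> R),
      [/\ cartan_coframe V D t1 t2 t3 t4 t5, smooth_on V f,
          forall q, V q -> f q != 0
        & forall q, V q -> g q = f q *: nurowski_metric t1 t2 t3 t4 t5 q].

(* As Nurowski's class is determined by D, and the vanishing of the Weyl tensor
   by the class, it does not matter which local representative is taken. *)
Definition maximally_symmetric {R : realType} (U : set 'rV[R]_5)
    (D : 'rV[R]_5 -> set 'rV[R]_5) : Prop :=
  forall p, U p -> exists V (g : 'rV[R]_5 -> 'M[R]_5),
    [/\ open_nbhd_in U p V, in_nurowski_class V D g & weyl_vanishes V g].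

(* The coordinates (z, theta, phi, x, q), in this order. *)
Definition i_z : 'I_5 := @Ordinal 5 0 isT.
Definition i_theta : 'I_5 := @Ordinal 5 1 isT.
Definition i_phi : 'I_5 := @Ordinal 5 2 isT.
Definition i_x : 'I_5 := @Ordinal 5 3 isT.
Definition i_q : 'I_5 := @Ordinal 5 4 isT.

Definition cz {R : realType} (p : 'rV[R]_5) : R := p 0 i_z.
Definition ctheta {R : realType} (p : 'rV[R]_5) : R := p 0 i_theta.
Definition cphi {R : realType} (p : 'rV[R]_5) : R := p 0 i_phi.
Definition cx {R : realType} (p : 'rV[R]_5) : R := p 0 i_x.
Definition cq {R : realType} (p : 'rV[R]_5) : R := p 0 i_q.

Definition dz {R : realType} : 'rV[R]_5 := delta_mx 0 i_z.
Definition dtheta {R : realType} : 'rV[R]_5 := delta_mx 0 i_theta.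
Definition dphi {R : realType} : 'rV[R]_5 := delta_mx 0 i_phi.
Definition dx {R : realType} : 'rV[R]_5 := delta_mx 0 i_x.
Definition dq {R : realType} : 'rV[R]_5 := delta_mx 0 i_q.

Definition M5 {R : realType} : set 'rV[R]_5 :=
  [set p | sin (ctheta p) != 0 /\ sin (cx p) != 0].

Local Open Scope complex_scope.

Definition toC {R : realType} {m n : nat} (A : 'M[R]_(m, n)) : 'M[R[i]]_(m, n) :=
  map_mx (real_complex R) A.

Definition expi {R : realType} (t : R) : R[i] := cos t +i* sin t.

Definition sigma1 {R : realType} (p : 'rV[R]_5) : 'rV[R]_5 :=
  sin (cz p) *: dtheta - (cos (cz p) * sin (ctheta p)) *: dphi.

Definition sigma2 {R : realType} (p : 'rV[R]_5) : 'rV[R]_5 :=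
  cos (cz p) *: dtheta + (sin (cz p) * sin (ctheta p)) *: dphi.

Definition eta1 {R : realType} (alpha : R) (p : 'rV[R]_5) : 'rV[R[i]]_5 :=
  toC (sigma2 p) + 'i%C *: toC (sigma1 p)
  + alpha%:C *: (toC dx - ('i%C * (sin (cx p))%:C) *: toC dq).

Definition eta2 {R : realType} (alpha : R) (p : 'rV[R]_5) : 'rV[R[i]]_5 :=
  toC (sigma2 p) - 'i%C *: toC (sigma1 p)
  + alpha%:C *: (toC dx + ('i%C * (sin (cx p))%:C) *: toC dq).

Definition eta3 {R : realType} (p : 'rV[R]_5) : 'rV[R[i]]_5 :=
  toC (- dz - cos (ctheta p) *: dphi + cos (cx p) *: dq).

Definition tau1 {R : realType} (p : 'rV[R]_5) : 'rV[R[i]]_5 :=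
  expi (cz p) *: (toC dtheta - ('i%C * (sin (ctheta p))%:C) *: toC dphi).

Definition tau2 {R : realType} (p : 'rV[R]_5) : 'rV[R[i]]_5 :=
  expi (- cz p) *: (toC dtheta + ('i%C * (sin (ctheta p))%:C) *: toC dphi).

Definition tau4 {R : realType} (p : 'rV[R]_5) : 'rV[R[i]]_5 :=
  expi (cz p) *: (toC dx - ('i%C * (sin (cx p))%:C) *: toC dq).

Definition tau5 {R : realType} (p : 'rV[R]_5) : 'rV[R[i]]_5 :=
  expi (- cz p) *: (toC dx + ('i%C * (sin (cx p))%:C) *: toC dq).

(* The real tangent vectors annihilated by eta_1, eta_2, eta_3. *)
Definition pfaff_kernel {R : realType} (alpha : R) (p : 'rV[R]_5) :
    set 'rV[R]_5 :=
  [set v | [/\ eta1 alpha p *m (toC v)^T = 0, eta2 alpha p *m (toC v)^T = 0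
             & eta3 p *m (toC v)^T = 0]].

(* The displayed metrics, for alpha = 1/3, -1/3 and for alpha = 3, -3. *)
Definition metric_thirdC {R : realType} (alpha : R) (p : 'rV[R]_5) :
    'M[R[i]]_5 :=
  9 *: symprod (eta1 alpha p) (eta2 alpha p) + 3 *: symprod (eta3 p) (eta3 p)
  - 18 *: symprod (tau1 p) (tau2 p) + 2 *: symprod (tau4 p) (tau5 p).

Definition metric_threeC {R : realType} (alpha : R) (p : 'rV[R]_5) :
    'M[R[i]]_5 :=
  symprod (eta1 alpha p) (eta2 alpha p) + 3 *: symprod (eta3 p) (eta3 p)
  + 2 *: symprod (tau1 p) (tau2 p) - 18 *: symprod (tau4 p) (tau5 p).

Definition metric_third {R : realType} (alpha : R) (p : 'rV[R]_5) : 'M[R]_5 :=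
  map_mx (@complex.Re R) (metric_thirdC alpha p).

Definition metric_three {R : realType} (alpha : R) (p : 'rV[R]_5) : 'M[R]_5 :=
  map_mx (@complex.Re R) (metric_threeC alpha p).

Definition metric_third_hat {R : realType} (alpha : R) (p : 'rV[R]_5) :
    'M[R]_5 :=
  (4 / cos (ctheta p) ^+ 2) *: metric_third alpha p.

Definition metric_three_hat {R : realType} (alpha : R) (p : 'rV[R]_5) :
    'M[R]_5 :=
  (4 / cos (cx p) ^+ 2) *: metric_three alpha p.

Definition swap_map {R : realType} (p : 'rV[R]_5) : 'rV[R]_5 :=
  \row_j [:: - cz p; cx p; cq p; ctheta p; cphi p]`_j.

(* Main.v *)
(* Both metrics are 12 (|dY|^2 - |dn|^2) for unit vectors n of R^3 and Y of R^4
   depending on the coordinates: they are induced on sections X = (n, Y) of the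
   null cone of flat R^{3,4}.  In a null frame (X, N, dX) with <X, N> = 1, the
   Gauss equation writes the curvature as the Kulkarni-Nomizu product of the
   metric and P = -<d^2 X, N>, so the Weyl tensor vanishes.  For a constant
   vector v, the section X / <X, v> induces a conformally rescaled metric with
   P = -<v, v>/2 times that metric: it is flat if v is null, and Einstein in
   general; the factor 4 / cos^2 comes from a multiple of the first basis vector.
   Cartan's structure equations are solved by an explicit coframe with constant
   coefficients in Re eta_1, Im eta_1, eta_3, dx and sin x dq, and the ranks of
   [D, D] and [[D, D], D] are read off these equations. *)
Require Import Defs.
From HB Require Import structures.
From mathcomp Require Import all_boot all_order all_algebra complex.
From mathcomp Require Import all_classical all_reals all_analysis.
From mathcomp Require Import ring.

Set Implicit Arguments.
Unset Strict Implicit.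
Unset Printing Implicit Defensive.

Import Order.TTheory GRing.Theory Num.Theory.
Import numFieldNormedType.Exports.

Local Open Scope classical_set_scope.
Local Open Scope ring_scope.

(** Expanding the curvature of a full 5 by 5 metric in Euler angles, with its inverse and two rounds
    of derivatives, would be unwieldy. The embedding confines the trigonometry to unit norms and
    Gram matrices of first derivatives; the curvature argument is then algebra in any dimension n.
    The embedding comes from completing the square. With s = sigma_2 + i sigma_1 and t = dx - i sin
    x dq, both metrics equal 3 (|s + eps t|^2 + eta_3^2) minus 12 times the round metric of one
    2-sphere, where eps is 1 or -1. The forms in the square are thus the Pfaffian forms for the
    parameter eps, not for alpha, and |s + eps t|^2 + eta_3^2 is 4 |dY|^2. All four values of alpha
    are handled by one family, indexed by a boolean and the sign eps. For conformal flatness near p,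
    the null vector v is the value at p of the null partner N of X, which makes <X, v> equal to 1 at
    p, hence positive nearby. *)

(** The local expansion of [f] at [p] is also one of [g], and uniqueness of the differential then
    identifies ['d g p] with ['d f p]. *)
Lemma near_eq_differentiable (K : numFieldType) (V W : normedModType K)
    (f g : V -> W) (p : V) :
  (\near p, f p = g p) -> differentiable f p -> differentiable g p.
Proof.
move=> fg df.
have gp : g p = f p by rewrite (nbhs_singleton fg).
have fg0 : \forall h \near (0 : V), f (h + p) = g (h + p).
  by move: fg; rewrite [X in X -> _](near_shift 0) subr0.
have gE : g \o shift p = cst (g p) + 'd f p +o_ 0 id.
  apply/eqaddoP => e e0; have /eqaddoP/(_ e e0) := diff_locally df.
  apply: filterS2 fg0 => h /= fgh.
  by rewrite !fctE /= gp -fgh.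
have dE : 'd g p = 'd f p :> (_ -> _).
  by apply: diff_unique gE; exact: diff_continuous.
by apply/diff_locallyP; rewrite dE; split=> //; exact: diff_continuous.
Qed.

(** * Partial derivatives of scalar functions *)

Section PartialDerivatives.
Context {R : realType} {n : nat}.
Implicit Types (f g : 'rV[R]_n -> R) (p : 'rV[R]_n) (i j : 'I_n).
Implicit Types U V : set 'rV[R]_n.

Lemma partial_near_eq f g p i : (\near p, f p = g p) ->
  partial i f p = partial i g p.
Proof. exact: near_eq_derive. Qed.

Lemma open_near_eq U f g p : open U -> U p -> (forall q, U q -> f q = g q) ->
  \near p, f p = g p.
Proof.
move=> oU Up fg; near=> q; apply: fg.
by near: q; exact: open_nbhs_nbhs.
Unshelve. all: by end_near. Qed.

Lemma partial_eq_on U f g p i : open U -> U p ->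
  (forall q, U q -> f q = g q) -> partial i f p = partial i g p.
Proof. by move=> oU Up fg; apply/partial_near_eq/(open_near_eq oU Up fg). Qed.

Lemma partial_cst (c : R) p i : partial i (fun=> c) p = 0.
Proof. exact: derive_cst. Qed.

Lemma partialD f g p i : differentiable f p -> differentiable g p ->
  partial i (fun q => f q + g q) p = partial i f p + partial i g p.
Proof.
by move=> df dg; rewrite /partial -deriveD//; exact: diff_derivable.
Qed.

Lemma partialN f p i : differentiable f p ->
  partial i (fun q => - f q) p = - partial i f p.
Proof.
by move=> df; rewrite /partial -deriveN//; exact: diff_derivable.
Qed.

Lemma partialB f g p i : differentiable f p -> differentiable g p ->
  partial i (fun q => f q - g q) p = partial i f p - partial i g p.
Proof.
by move=> df dg; rewrite /partial -deriveB//; exact: diff_derivable.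
Qed.

Lemma partialM f g p i : differentiable f p -> differentiable g p ->
  partial i (fun q => f q * g q) p = partial i f p * g p + f p * partial i g p.
Proof.
move=> df dg; rewrite /partial; have := @deriveM _ _ f g p (delta_mx 0 i).
move=> ->; [|exact: diff_derivable..].
by rewrite addrC; congr (_ + _); rewrite /GRing.scale/= mulrC.
Qed.

Lemma differentiable_bigsum (I : Type) (r : seq I) (P : pred I)
    (F : I -> 'rV[R]_n -> R) p : (forall k, P k -> differentiable (F k) p) ->
  differentiable (fun q => \sum_(k <- r | P k) F k q) p.
Proof.
move=> dF; elim: r => [|a r IH].
  rewrite (_ : (fun _ => _) = cst 0); first exact: differentiable_cst.
  by apply/funext => q; rewrite big_nil.
have [Pa|nPa] := boolP (P a).
  rewrite (_ : (fun _ => _) = F a + fun q => \sum_(k <- r | P k) F k q).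
    by apply: differentiableD; [exact: dF|exact: IH].
  by apply/funext => q; rewrite big_cons Pa.
rewrite (_ : (fun _ => _) = fun q => \sum_(k <- r | P k) F k q); first exact: IH.
by apply/funext => q; rewrite big_cons (negbTE nPa).
Qed.

Lemma partial_sum (I : Type) (r : seq I) (P : pred I)
    (F : I -> 'rV[R]_n -> R) p i : (forall k, P k -> differentiable (F k) p) ->
  partial i (fun q => \sum_(k <- r | P k) F k q) p =
  \sum_(k <- r | P k) partial i (F k) p.
Proof.
move=> dF; elim: r => [|a r IH].
  rewrite big_nil -[RHS](partial_cst 0 p i); congr partial.
  by apply/funext => q; rewrite big_nil.
rewrite big_cons -IH; case: ifPn => Pa.
  rewrite -partialD; [|exact: dF|exact: differentiable_bigsum].
  by congr partial; apply/funext => q; rewrite big_cons Pa.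
by congr partial; apply/funext => q; rewrite big_cons (negbTE Pa).
Qed.

Lemma partial_coord p i j : partial i (fun q => q 0 j) p = (i == j)%:R.
Proof.
pose f (q : 'rV[R]_n) : R := q 0 j.
have f_lin : linear f by move=> a u v; rewrite /f !mxE.
(* Packed as a linear map, the coordinate is its own differential. *)
pose fM := GRing.isLinear.Build _ _ _ _ _ f_lin.
pose fL : {linear _ -> _} := HB.pack f fM.
rewrite /partial deriveE; last exact: differentiable_coord.
rewrite (_ : 'd _ p = fL :> (_ -> _)); last first.
  by apply: (@diff_lin _ _ _ fL); exact: coord_continuous.
by rewrite /fL/= /f mxE eqxx/= eq_sym.
Qed.

Lemma partial_comp (h : R -> R) (dh : R) f p :
  is_derive (f p) 1 h dh -> differentiable f p ->
  differentiable (h \o f) p /\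
  forall i, partial i (h \o f) p = dh * partial i f p.
Proof.
move=> dhf df.
have dh' : differentiable h (f p) by apply/derivable1_diffP/ex_derive.
have dc : differentiable (h \o f) p by exact: differentiable_comp.
split=> // i; rewrite /partial !deriveE// diff_comp//= diff1E// derive1E derive_val.
by rewrite /GRing.scale/= mulrC.
Qed.

Lemma partialV f p i : differentiable f p -> f p != 0 ->
  partial i (fun q => (f q)^-1) p = - (f p)^-1 ^+ 2 * partial i f p.
Proof.
move=> df f0; rewrite /partial !deriveE ?diffV//; last exact: differentiableV.
by rewrite exprVn.
Qed.

End PartialDerivatives.
(* Smoothness, differentiation and the symmetry of second derivatives are
   obtained by reflection: symbolic differentiation of a syntactic expression
   stays inside the class, and symbolic second derivatives commute. *)
Inductive expr (R : Type) (n : nat) : Type :=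
| ECst of R
| EVar of 'I_n
| EAdd of expr R n & expr R n
| EMul of expr R n & expr R n
| ESin of expr R n
| ECos of expr R n
| EInv of expr R n.

Arguments ECst {R n}.
Arguments EVar {R n}.

(** * Elementary functions on open sets *)

Section Elementary.
Context {R : realType} {n : nat}.
Implicit Types (f g : 'rV[R]_n -> R) (p : 'rV[R]_n) (i j : 'I_n).
Implicit Types (U V : set 'rV[R]_n) (e : expr R n).

Fixpoint eeval e (p : 'rV[R]_n) : R :=
  match e with
  | ECst c => c
  | EVar j => p 0 j
  | EAdd a b => eeval a p + eeval b p
  | EMul a b => eeval a p * eeval b p
  | ESin a => sin (eeval a p)
  | ECos a => cos (eeval a p)
  | EInv a => (eeval a p)^-1
  end.

(** Inversion is total, with value 0 at 0, so the nonvanishing of each denominator has to be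
    recorded for differentiability. *)
Fixpoint ewd e (p : 'rV[R]_n) : Prop :=
  match e with
  | ECst _ | EVar _ => True
  | EAdd a b | EMul a b => ewd a p /\ ewd b p
  | ESin a | ECos a => ewd a p
  | EInv a => ewd a p /\ eeval a p != 0
  end.

Fixpoint ederiv i e : expr R n :=
  match e with
  | ECst _ => ECst 0
  | EVar j => ECst (i == j)%:R
  | EAdd a b => EAdd (ederiv i a) (ederiv i b)
  | EMul a b => EAdd (EMul (ederiv i a) b) (EMul a (ederiv i b))
  | ESin a => EMul (ECos a) (ederiv i a)
  | ECos a => EMul (EMul (ECst (-1)) (ESin a)) (ederiv i a)
  | EInv a => EMul (EMul (ECst (-1)) (EMul (EInv a) (EInv a))) (ederiv i a)
  end.

(** Derivation only repeats denominators that already occur, so the condition survives to every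
    order. *)
Lemma ewd_deriv i e p : ewd e p -> ewd (ederiv i e) p.
Proof.
elim: e => //= [a IHa b IHb|a IHa b IHb|a IHa|a IHa|a IHa].
- by move=> [/IHa ? /IHb].
- by move=> [wa wb]; do ![split=> //]; [exact: IHa|exact: IHb].
- by move=> wa; split=> //; exact: IHa.
- by move=> wa; do ![split=> //]; exact: IHa.
- by move=> [wa a0]; do ![split=> //]; exact: IHa.
Qed.

Lemma eeval_diff e p : ewd e p -> differentiable (eeval e) p /\
  forall i, partial i (eeval e) p = eeval (ederiv i e) p.
Proof.
elim: e => /= [c|j|a IHa b IHb|a IHa b IHb|a IHa|a IHa|a IHa].
- by move=> _; split; [exact: differentiable_cst|move=> i; rewrite partial_cst].
- by move=> _; split; [exact: differentiable_coord|move=> i; exact: partial_coord].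
- move=> [/IHa[da pa] /IHb[db pb]]; split=> [|i]; first exact: differentiableD.
  by rewrite partialD// pa pb.
- move=> [/IHa[da pa] /IHb[db pb]]; split=> [|i]; first exact: differentiableM.
  by rewrite partialM// pa pb.
- move=> /IHa[da pa]; have [dc pc] := partial_comp (is_derive_sin (eeval a p)) da.
  by split=> // i; rewrite -pa; rewrite (pc i).
- move=> /IHa[da pa]; have [dc pc] := partial_comp (is_derive_cos (eeval a p)) da.
  by split=> // i; rewrite -pa; rewrite (pc i) mulN1r.
- move=> [/IHa[da pa] a0]; split=> [|i]; first exact: differentiableV.
  by rewrite partialV// pa expr2 mulN1r.
Qed.

(** A syntactic Schwarz theorem: both sides are the same polynomial in the values of the subterms,
    their inverses and their symbolic derivatives. *)
Lemma ederiv_comm i j e p :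
  eeval (ederiv i (ederiv j e)) p = eeval (ederiv j (ederiv i e)) p.
Proof.
elim: e => //= [a IHa b IHb|a IHa b IHb|a IHa|a IHa|a IHa];
  rewrite ?IHa ?IHb; ring.
Qed.

(** One expression has to serve on all of [U]; its symbolic derivative then represents the partial
    derivative on all of an open [U]. *)
Definition elem U f := exists e, forall p, U p -> ewd e p /\ f p = eeval e p.

Lemma elem_eq U f g : (forall p, U p -> f p = g p) -> elem U f -> elem U g.
Proof. by move=> fg [e ef]; exists e => p Up; rewrite -fg//; exact: ef. Qed.

Lemma elem_cst U (c : R) : elem U (fun=> c).
Proof. by exists (ECst c). Qed.

Lemma elem_coord U j : elem U (fun p => p 0 j).
Proof. by exists (EVar j). Qed.

Lemma elemD U f g : elem U f -> elem U g -> elem U (fun p => f p + g p).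
Proof.
move=> [a af] [b bg]; exists (EAdd a b) => p Up /=.
by have [? ->] := af _ Up; have [? ->] := bg _ Up.
Qed.

Lemma elemM U f g : elem U f -> elem U g -> elem U (fun p => f p * g p).
Proof.
move=> [a af] [b bg]; exists (EMul a b) => p Up /=.
by have [? ->] := af _ Up; have [? ->] := bg _ Up.
Qed.

Lemma elemN U f : elem U f -> elem U (fun p => - f p).
Proof.
move=> ef; apply: elem_eq (elemM (elem_cst U (-1)) ef) => p _.
by rewrite mulN1r.
Qed.

Lemma elemB U f g : elem U f -> elem U g -> elem U (fun p => f p - g p).
Proof. by move=> ef eg; apply: elemD => //; exact: elemN. Qed.

Lemma elemX U f k : elem U f -> elem U (fun p => f p ^+ k).
Proof.
move=> ef; elim: k => [|k IH]; first exact: elem_cst.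
by apply: elem_eq (elemM ef IH) => p _; rewrite exprS.
Qed.

Lemma elem_sin U f : elem U f -> elem U (fun p => sin (f p)).
Proof.
by move=> [a af]; exists (ESin a) => p Up /=; have [? ->] := af _ Up.
Qed.

Lemma elem_cos U f : elem U f -> elem U (fun p => cos (f p)).
Proof.
by move=> [a af]; exists (ECos a) => p Up /=; have [? ->] := af _ Up.
Qed.

Lemma elemV U f : elem U f -> (forall p, U p -> f p != 0) ->
  elem U (fun p => (f p)^-1).
Proof.
move=> [a af] f0; exists (EInv a) => p Up /=.
by have := f0 _ Up; have [? ->] := af _ Up.
Qed.

Lemma elem_sum U (I : Type) (r : seq I) (P : pred I)
    (F : I -> 'rV[R]_n -> R) : (forall k, elem U (F k)) ->
  elem U (fun q => \sum_(k <- r | P k) F k q).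
Proof.
move=> eF; elim: r => [|a r IH].
  by apply: elem_eq (elem_cst U 0) => p _; rewrite big_nil.
case Pa: (P a).
  by apply: elem_eq (elemD (eF a) IH) => p _; rewrite big_cons Pa.
by apply: elem_eq IH => p _; rewrite big_cons Pa.
Qed.

Lemma elem_prod U (I : Type) (r : seq I) (P : pred I)
    (F : I -> 'rV[R]_n -> R) : (forall k, elem U (F k)) ->
  elem U (fun q => \prod_(k <- r | P k) F k q).
Proof.
move=> eF; elim: r => [|a r IH].
  by apply: elem_eq (elem_cst U 1) => p _; rewrite big_nil.
case Pa: (P a).
  by apply: elem_eq (elemM (eF a) IH) => p _; rewrite big_cons Pa.
by apply: elem_eq IH => p _; rewrite big_cons Pa.
Qed.

Lemma elem_det U m (A : 'rV[R]_n -> 'M[R]_m) :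
  (forall k l, elem U (fun p => A p k l)) -> elem U (fun p => \det (A p)).
Proof.
move=> eA; apply: elem_sum => s; apply: elemM; first exact: elem_cst.
by apply: elem_prod => k; exact: eA.
Qed.

(** Cramer's rule: cofactors and determinant are polynomials in the entries, and invertibility keeps
    the only new denominator nonzero. *)
Lemma elem_invmx U m (A : 'rV[R]_n -> 'M[R]_m) :
  (forall k l, elem U (fun p => A p k l)) ->
  (forall p, U p -> A p \in unitmx) ->
  forall k l, elem U (fun p => invmx (A p) k l).
Proof.
move=> eA uA k l.
have ec : elem U (fun p => cofactor (A p) l k).
  apply: elemM; first exact: elem_cst.
  apply: elem_det => a b.
  by apply: elem_eq (eA (lift l a) (lift k b)) => p _; rewrite !mxE.
have ed : elem U (fun p => (\det (A p))^-1).
  by apply: elemV (elem_det eA) _ => p /uA; rewrite unitmxE unitfE.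
by apply: elem_eq (elemM ed ec) => p /uA uAp; rewrite /invmx uAp !mxE.
Qed.

Section Open.
Variables (U : set 'rV[R]_n) (oU : open U).

Lemma elem_differentiable f p : elem U f -> U p -> differentiable f p.
Proof.
move=> [e ef] Up.
have := (eeval_diff (ef _ Up).1).1; apply: near_eq_differentiable.
by apply: (open_near_eq oU Up) => q /ef[_ ->].
Qed.

Lemma elem_partialE f : elem U f -> exists e, [/\ forall p, U p -> ewd e p,
  forall p, U p -> f p = eeval e p &
  forall p i, U p -> partial i f p = eeval (ederiv i e) p].
Proof.
move=> [e ef]; exists e; split=> [p /ef[]//|p /ef[]//|p i Up].
rewrite -(eeval_diff (ef _ Up).1).2; apply: (partial_eq_on _ oU Up).
by move=> q /ef[].
Qed.

Lemma elem_partial f i : elem U f -> elem U (partial i f).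
Proof.
move=> /elem_partialE[e [we _ pe]]; exists (ederiv i e) => p Up.
by split; [exact/ewd_deriv/we|exact: pe].
Qed.

Lemma elem_smooth f : elem U f -> smooth_on U f.
Proof.
move=> ef k; elim: k f ef => [|k IH] f ef /=.
  by move=> p Up; apply/differentiable_continuous/elem_differentiable.
split=> [p Up|i]; first exact: elem_differentiable.
by apply/IH/elem_partial.
Qed.

Lemma partial_comm f i j p : elem U f -> U p ->
  partial i (partial j f) p = partial j (partial i f) p.
Proof.
move=> /elem_partialE[e [we _ pe]] Up.
have H a b : partial a (partial b f) p = eeval (ederiv a (ederiv b e)) p.
  have [_ <-] := eeval_diff (ewd_deriv b (we _ Up)).
  by apply: (partial_eq_on _ oU Up) => q; exact: pe.
by rewrite !H ederiv_comm.
Qed.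

End Open.

End Elementary.

(** * Null frames and the Gauss equation *)

Section InnerProduct.
Context {K : comPzRingType} {m : nat}.
Implicit Types h a b c : 'I_m -> K.

Definition ip h a b : K := \sum_k h k * a k * b k.

Lemma ipC h a b : ip h a b = ip h b a.
Proof. by apply: eq_bigr => k _; rewrite mulrAC. Qed.

Lemma eq_ip h a b a' b' : a =1 a' -> b =1 b' -> ip h a b = ip h a' b'.
Proof. by move=> ea eb; apply: eq_bigr => k _; rewrite ea eb. Qed.

Lemma ipDr h a b c : ip h a (fun k => b k + c k) = ip h a b + ip h a c.
Proof. by rewrite -big_split; apply: eq_bigr => k _; rewrite mulrDr. Qed.

Lemma ipZr h a (x : K) b : ip h a (fun k => x * b k) = x * ip h a b.
Proof. by rewrite mulr_sumr; apply: eq_bigr => k _; ring. Qed.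

Lemma ipDl h a b c : ip h (fun k => b k + c k) a = ip h b a + ip h c a.
Proof. by rewrite ipC ipDr !(ipC h a). Qed.

Lemma ipZl h a (x : K) b : ip h (fun k => x * b k) a = x * ip h b a.
Proof. by rewrite ipC ipZr ipC. Qed.

End InnerProduct.

(** Completeness of the frame (X, N, E): its Gram matrix is a hyperbolic plane plus [g], so the dual
    frame is explicit and the identity operator can be inserted between [v] and [w]. *)
Lemma null_frame_expand (K : fieldType) (n : nat) (h X N : 'I_(2 + n) -> K)
    (E : 'I_n -> 'I_(2 + n) -> K) (g : 'M[K]_n) :
  g \in unitmx -> ip h X X = 0 -> ip h X N = 1 -> ip h N N = 0 ->
  (forall i, ip h X (E i) = 0) -> (forall i, ip h N (E i) = 0) ->
  (forall i j, ip h (E i) (E j) = g i j) ->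
  forall v w, ip h v w = ip h v N * ip h X w + ip h v X * ip h N w +
    \sum_i ip h v (E i) * (\sum_j invmx g i j * ip h w (E j)).
Proof.
move=> gu XX XN NN XE NE EE v w.
pose H : 'M[K]_(2 + n) := diag_mx (\row_k h k).
pose r (f : 'I_(2 + n) -> K) : 'rV[K]_(2 + n) := \row_k f k.
have ipE a b : r a *m H *m (r b)^T = (ip h a b)%:M.
  apply/matrixP => i j; rewrite !ord1 !mxE eqxx mulr1n; apply: eq_bigr => k _.
  by rewrite mul_mx_diag !mxE; ring.
pose M : 'M[K]_(n, 2 + n) := \matrix_(i, k) E i k.
have rM i : row i M = r (E i) by apply/rowP => k; rewrite !mxE.
have ipM a : r a *m H *m M^T = \row_i ip h a (E i).
  apply/rowP => i; rewrite !mxE; apply: eq_bigr => k _.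
  by rewrite mul_mx_diag !mxE; ring.
have Mip a : M *m H *m (r a)^T = \col_i ip h a (E i).
  apply/colP => i; rewrite !mxE; apply: eq_bigr => k _.
  by rewrite mul_mx_diag !mxE; ring.
have MM : M *m H *m M^T = g.
  apply/matrixP => i j; rewrite -EE mxE; apply: eq_bigr => k _.
  by rewrite mul_mx_diag !mxE; ring.
pose F : 'M[K]_(1 + 1 + n, 2 + n) := col_mx (col_mx (r X) (r N)) M.
(* The dual frame: X and N trade places since they are null with product 1, and the E are raised by
   the inverse of [g]. *)
pose F' : 'M[K]_(1 + 1 + n, 2 + n) :=
  col_mx (col_mx (r N) (r X)) ((invmx g)^T *m M).
have FF' : F *m (H *m F'^T) = 1%:M.
  have X0 : \row_i ip h X (E i) = 0 by apply/rowP => i; rewrite !mxE.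
  have N0 : \row_i ip h N (E i) = 0 by apply/rowP => i; rewrite !mxE.
  have X0' : \col_i ip h X (E i) = 0 by apply/colP => i; rewrite !mxE.
  have N0' : \col_i ip h N (E i) = 0 by apply/colP => i; rewrite !mxE.
  rewrite !tr_col_mx trmx_mul trmxK mulmxA mul_col_mx mul_mx_row.
  rewrite !(mul_col_mx, mul_mx_row) !mulmxA MM !ipM !Mip !ipE X0 N0 X0' N0'.
  rewrite XX NN XN (ipC h N X) XN mulmxV// !mul0mx.
  by rewrite !raddf0 row_mx0 col_mx0 -!block_mxEh -!scalar_mx_block.
(* A one-sided inverse of a square matrix is two-sided, which turns duality into completeness. *)
have F'F : (H *m F'^T) *m F = 1%:M by exact: mulmx1C.
have : r v *m H *m (r w)^T = r v *m ((H *m F'^T) *m F) *m (H *m (r w)^T).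
  by rewrite F'F mulmx1 mulmxA.
rewrite !tr_col_mx trmx_mul trmxK mul_mx_row mul_row_col mul_mx_row.
rewrite mul_row_col !(mulmxDl, mulmxDr) !mulmxA.
rewrite !ipE ipM -!(mulmxA _ _ H) -!(mulmxA _ (_ *m H)) ipE ipE Mip.
rewrite -!scalar_mxM => /matrixP/(_ 0 0); rewrite !mxE eqxx !mulr1n => ->.
congr (_ + _); under eq_bigr do rewrite !mxE mulr_suml.
rewrite exchange_big; apply: eq_bigr => i _; rewrite mulr_sumr.
by apply: eq_bigr => j _; rewrite !mxE mulrA.
Qed.

Lemma sum_mulmxV (K : fieldType) n (g : 'M[K]_n) (f : 'I_n -> K) a :
  g \in unitmx -> \sum_m g a m * (\sum_l invmx g m l * f l) = f a.
Proof.
move=> gu; have : (g *m (invmx g *m \col_l f l)) a 0 = f a.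
  by rewrite mulmxA mulmxV// mul1mx mxE.
move=> <-; rewrite mxE; apply: eq_bigr => m _; congr (_ * _).
by rewrite mxE; apply: eq_bigr => l _; rewrite mxE.
Qed.

(** The Gauss equation at one point, freed from calculus: E, S, T stand for the first, second and
    third derivatives of X, [c] for the Christoffel symbols and [dc] for their derivatives. The
    hypothesis on [dc] is the derivative of the relation g c = <S, E>. *)
Lemma gauss_algebra (K : fieldType) (n : nat) (h X N : 'I_(2 + n) -> K)
    (E : 'I_n -> 'I_(2 + n) -> K) (S : 'I_n -> 'I_n -> 'I_(2 + n) -> K)
    (T : 'I_n -> 'I_n -> 'I_n -> 'I_(2 + n) -> K) (g : 'M[K]_n)
    (c : 'I_n -> 'I_n -> 'I_n -> K) (dc : 'I_n -> 'I_n -> 'I_n -> 'I_n -> K) :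
  g \in unitmx -> ip h X X = 0 -> ip h X N = 1 -> ip h N N = 0 ->
  (forall i, ip h X (E i) = 0) -> (forall i, ip h N (E i) = 0) ->
  (forall i j, ip h (E i) (E j) = g i j) ->
  (forall i j, ip h X (S i j) = - g i j) ->
  (forall k i j, c k i j = \sum_l invmx g k l * ip h (S i j) (E l)) ->
  (forall a b d, T a b d = T b a d) ->
  (forall l a b d,
    \sum_m ((ip h (S a l) (E m) + ip h (E l) (S a m)) * c m b d
            + g l m * dc a m b d) = ip h (T a b d) (E l) + ip h (S b d) (S a l)) ->
  forall l k i j,
  \sum_m g l m * (dc i m j k - dc j m i k
                  + \sum_r (c m i r * c r j k - c m j r * c r i k)) =
  g i l * - ip h (S j k) N + g j k * - ip h (S i l) N
  - g j l * - ip h (S i k) N - g i k * - ip h (S j l) N.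
Proof.
move=> gu XX XN NN XE NE EE XS cE TC dcE l k i j.
have gc a b d : \sum_m g a m * c m b d = ip h (S b d) (E a).
  by under eq_bigr do rewrite cE; rewrite sum_mulmxV.
(* The X-pairing of a second derivative is minus the metric; in the null frame it multiplies the
   N-pairing of the other factor, which produces the products of g and P. *)
have expand a b d e : ip h (S a b) (S d e) =
    - (g d e * ip h (S a b) N) - g a b * ip h (S d e) N
    + \sum_m ip h (S a b) (E m) * c m d e.
  rewrite (null_frame_expand gu XX XN NN XE NE EE) (ipC h (S a b) X).
  rewrite (ipC h N (S d e)) !XS mulrN mulNr mulrC.
  by congr (_ + _); apply: eq_bigr => m _; rewrite cE.
have quad a b d : \sum_m g l m * (\sum_r c m a r * c r b d) =
    \sum_m ip h (E l) (S a m) * c m b d.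
  under eq_bigr do rewrite mulr_sumr.
  rewrite exchange_big; apply: eq_bigr => r _ /=.
  under eq_bigr do rewrite mulrA.
  by rewrite -mulr_suml gc ipC.
have dcE' a b d : \sum_m g l m * dc a m b d =
    ip h (T a b d) (E l) + ip h (S b d) (S a l)
    - \sum_m ip h (S a l) (E m) * c m b d
    - \sum_m ip h (E l) (S a m) * c m b d.
  rewrite -dcE -!sumrB; apply: eq_bigr => m _; ring.
have -> : \sum_m g l m * (dc i m j k - dc j m i k
      + \sum_r (c m i r * c r j k - c m j r * c r i k)) =
    \sum_m g l m * dc i m j k - \sum_m g l m * dc j m i k
    + \sum_m g l m * (\sum_r c m i r * c r j k)
    - \sum_m g l m * (\sum_r c m j r * c r i k).
  by rewrite -sumrB -big_split -sumrB; apply: eq_bigr => m _; rewrite /= sumrB; ring.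
(* Antisymmetry in i, j cancels the third derivatives, and the tangential parts of the products <S,
   S> cancel against the Christoffel terms. *)
rewrite !dcE' !quad (TC j i) (ipC h (S j k)) (ipC h (S i k)).
rewrite (expand i l) (expand j l); ring.
Qed.

Section Gauss.
Context {R : realType} {n m : nat}.
Variables (h : 'I_m -> R).
Implicit Types (A B : 'I_m -> 'rV[R]_n -> R) (p : 'rV[R]_n).

Lemma partial_ip A B p i :
  (forall k, differentiable (A k) p) -> (forall k, differentiable (B k) p) ->
  partial i (fun q => ip h (A^~ q) (B^~ q)) p =
  ip h (fun k => partial i (A k) p) (B^~ p) +
  ip h (A^~ p) (fun k => partial i (B k) p).
Proof.
move=> dA dB; have dh k : differentiable (fun=> h k : R) p.
  exact: differentiable_cst.
rewrite partial_sum => [|k _]; last first.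
  exact: differentiableM (differentiableM (dh k) (dA k)) (dB k).
rewrite -big_split; apply: eq_bigr => k _ /=.
by rewrite !partialM ?partial_cst ?mul0r ?add0r//; exact: differentiableM.
Qed.

Lemma partial_ip_cst (v : 'I_m -> R) B p i :
  (forall k, differentiable (B k) p) ->
  partial i (fun q => ip h v (B^~ q)) p = ip h v (fun k => partial i (B k) p).
Proof.
move=> dB; have dv k : differentiable (fun=> v k : R) p.
  exact: differentiable_cst.
rewrite (@partial_ip (fun k => fun=> v k))//.
(* The zero derivative is written as a scalar multiple so that [ipZl] removes its term. *)
rewrite (@eq_ip _ _ h _ (B^~ p) (fun=> 0 * 0) (B^~ p)) => [|k|//].
  by rewrite ipZl mul0r add0r.
by rewrite partial_cst mul0r.
Qed.

Lemma elem_ip U A B : (forall k, elem U (A k)) -> (forall k, elem U (B k)) ->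
  elem U (fun q => ip h (A^~ q) (B^~ q)).
Proof.
move=> eA eB; apply: elem_sum => k.
by apply: elemM (eB k); apply: elemM (eA k); exact: elem_cst.
Qed.

End Gauss.

(* X immerses U in a null cone; N completes X and its derivatives into a null
   frame of the ambient space. *)
Section ConeEmbedding.
Context {R : realType} {n : nat}.
Variables (h : 'I_(2 + n) -> R) (U : set 'rV[R]_n).
Variables (X N : 'I_(2 + n) -> 'rV[R]_n -> R) (g : 'rV[R]_n -> 'M[R]_n).
Hypotheses (oU : open U) (eX : forall k, elem U (X k)).
Hypothesis gu : forall p, U p -> g p \in unitmx.
Hypothesis XX : forall p, U p -> ip h (X^~ p) (X^~ p) = 0.
Hypothesis XN : forall p, U p -> ip h (X^~ p) (N^~ p) = 1.
Hypothesis NN : forall p, U p -> ip h (N^~ p) (N^~ p) = 0.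
Hypothesis ND : forall p i, U p ->
  ip h (N^~ p) (fun k => partial i (X k) p) = 0.
Hypothesis DD : forall p i j, U p ->
  ip h (fun k => partial i (X k) p) (fun k => partial j (X k) p) = g p i j.

#[local] Opaque ip partial.

Let D i p k := partial i (X k) p.
Let S i j p k := partial i (partial j (X k)) p.

Let SC i j p : U p -> S i j p = S j i p.
Proof. by move=> Up; apply/funext => k; exact: (partial_comm oU). Qed.

Let dX k p : U p -> differentiable (X k) p.
Proof. exact: (elem_differentiable oU (eX k)). Qed.

Let dD k i p : U p -> differentiable (partial i (X k)) p.
Proof. exact/(elem_differentiable oU)/elem_partial. Qed.

Let eD i k : elem U (partial i (X k)).
Proof. exact: elem_partial. Qed.

Let eS i j k : elem U (partial i (partial j (X k))).
Proof. exact: elem_partial. Qed.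

Let eg i j : elem U (fun p => g p i j).
Proof.
apply: (@elem_eq _ _ _ (fun p => ip h (D i p) (D j p))) => [p Up|].
  exact: DD.
exact: (elem_ip h (eD i) (eD j)).
Qed.

Let XD i p : U p -> ip h (X^~ p) (D i p) = 0.
Proof.
move=> Up; have := partial_cst 0 p i.
rewrite -(partial_eq_on i oU Up XX) partial_ip => [|k|k]; [|exact: dX..].
by rewrite (ipC _ _ (X^~ p)) -mulr2n => /eqP; rewrite mulrn_eq0/= => /eqP.
Qed.

(** Differentiating <X, d_j X> = 0, itself the derivative of <X, X> = 0, trades the second
    derivative for the metric. *)
Lemma cone_second i j p : U p -> ip h (X^~ p) (S i j p) = - g p i j.
Proof.
move=> Up; have := partial_cst 0 p i.
rewrite -(partial_eq_on i oU Up (XD j)) partial_ip => [|k|k];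
  [|exact: dX|exact: dD].
by rewrite DD// addrC => /eqP; rewrite addr_eq0 => /eqP.
Qed.

Let dg k i j p : U p -> partial k (fun q => g q i j) p =
  ip h (S k i p) (D j p) + ip h (D i p) (S k j p).
Proof.
move=> Up; rewrite -(partial_eq_on k oU Up (fun q => @DD q i j)).
by rewrite partial_ip => // l; exact: dD.
Qed.

Lemma cone_sym i j p : U p -> g p i j = g p j i.
Proof. by move=> Up; rewrite -(DD i j Up) -(DD j i Up) ipC. Qed.

(** As for any immersion in a flat space: each derivative of the metric gives two terms <S, D>, and
    four of the six cancel because second derivatives commute. *)
Let chr k i j p : U p -> christoffel g k i j p =
  \sum_l invmx (g p) k l * ip h (S i j p) (D l p).
Proof.
move=> Up; rewrite /christoffel mulr_sumr; apply: eq_bigr => l _.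
rewrite (dg i j l Up) (dg j i l Up) (dg l i j Up) (SC j i Up) (SC l i Up).
rewrite (SC l j Up) (ipC _ (D j p)) (ipC _ (D i p)).
have aux (d a b c : R) : 2^-1 * (d * (a + b + (a + c) - (b + c))) = d * a.
  by field.
exact: aux.
Qed.

#[local] Opaque christoffel.

Let ec k i j : elem U (christoffel g k i j).
Proof.
apply: (@elem_eq _ _ _ (fun p => \sum_l invmx (g p) k l * ip h (S i j p) (D l p))).
  by move=> p Up; rewrite chr.
apply: elem_sum => l; apply: elemM; first exact: (elem_invmx eg).
exact: (elem_ip h (eS i j) (eD l)).
Qed.

Definition schouten p i j := - ip h (S i j p) (N^~ p).

Lemma schoutenC p i j : U p -> schouten p i j = schouten p j i.
Proof. by move=> Up; rewrite /schouten SC. Qed.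

Lemma gauss_cone p l k i j : U p ->
  \sum_m g p l m * riemann g m k i j p =
  g p i l * schouten p j k + g p j k * schouten p i l
  - g p j l * schouten p i k - g p i k * schouten p j l.
Proof.
move=> Up.
pose T a b c r := partial a (fun q => S b c q r) p.
have TC a b c : T a b c = T b a c.
  by apply/funext => r; exact: (partial_comm oU a b (eD c r) Up).
have gchr l' b c q : U q ->
    \sum_m g q l' m * christoffel g m b c q = ip h (S b c q) (D l' q).
  move=> Uq; under eq_bigr => m _ do rewrite (chr m b c Uq).
  exact: (sum_mulmxV (fun l => ip h (S b c q) (D l q)) l' (gu Uq)).
have dcE l' a b c : \sum_m ((ip h (S a l' p) (D m p) + ip h (D l' p) (S a m p)) *
      christoffel g m b c p + g p l' m * partial a (christoffel g m b c) p) =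
    ip h (T a b c) (D l' p) + ip h (S b c p) (S a l' p).
  (* The lowered Christoffel symbols are differentiated as inner products, which avoids the
     derivative of the inverse metric. *)
  have := partial_eq_on a oU Up (fun q => @gchr l' b c q).
  rewrite partial_sum => [|m _]; last first.
    by apply: differentiableM; apply: (elem_differentiable oU _ Up).
  rewrite partial_ip => [|r|r]; last exact: dD.
    move=> <-; apply: eq_bigr => m _.
    rewrite partialM; [|exact: (elem_differentiable oU (eg l' m) Up)
      |exact: (elem_differentiable oU (ec m b c) Up)].
    by rewrite (dg a l' m Up).
  exact: (elem_differentiable oU (eS b c r) Up).
exact: (@gauss_algebra R n h (X^~ p) (N^~ p) (fun i => D i p)
  (fun i j => S i j p) T (g p) (fun m a b => christoffel g m a b p)
  (fun a m b c => partial a (christoffel g m b c) p) (gu Up) (XX Up) (XN Up)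
  (NN Up) (fun i => XD i Up) (fun i => ND i Up) (fun i j => DD i j Up)
  (fun i j => cone_second i j Up) (fun m a b => chr m a b Up) TC dcE).
Qed.

End ConeEmbedding.

(** * Curvature tensors that are Kulkarni-Nomizu products with the metric *)

Lemma sum_invmx_tr (K : fieldType) n (g : 'M[K]_n) :
  g \in unitmx -> (forall i j, g i j = g j i) ->
  \sum_i \sum_j invmx g i j * g i j = n%:R.
Proof.
move=> gu gC; rewrite -[n in RHS]card_ord -sumr_const; apply: eq_bigr => i _.
have /matrixP/(_ i i) := mulVmx gu; rewrite !mxE eqxx => e.
by rewrite -[RHS]e; apply: eq_bigr => l _; rewrite gC.
Qed.

Section SchoutenForm.
Context {R : realType} {n : nat}.
Variables (g : 'rV[R]_n -> 'M[R]_n) (p : 'rV[R]_n) (P : 'M[R]_n).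
Hypothesis gu : g p \in unitmx.
Hypotheses (gC : forall i j, g p i j = g p j i) (PC : forall i j, P i j = P j i).
Hypothesis curv : forall l k i j, \sum_m g p l m * riemann g m k i j p =
  g p i l * P j k + g p j k * P i l - g p j l * P i k - g p i k * P j l.

Let t := \sum_i \sum_l invmx (g p) i l * P i l.

Let riemE m k i j : riemann g m k i j p = \sum_l invmx (g p) m l *
  (g p i l * P j k + g p j k * P i l - g p j l * P i k - g p i k * P j l).
Proof.
have : (invmx (g p) *m (g p *m \col_m riemann g m k i j p)) m 0 =
    riemann g m k i j p by rewrite mulmxA mulVmx// mul1mx mxE.
move=> <-; rewrite mxE; apply: eq_bigr => l _; congr (_ * _).
by rewrite -curv mxE; apply: eq_bigr => r _; rewrite mxE.
Qed.

(** Contraction of the four terms of the Kulkarni-Nomizu product gives n P, t g, - P and - P in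
    turn. *)
Lemma schouten_ricci : ricci g p = (n%:R - 2) *: P + t *: g p.
Proof.
have ig i j : \sum_l invmx (g p) i l * g p l j = (i == j)%:R.
  by have /matrixP/(_ i j) := mulVmx gu; rewrite !mxE.
have ig' i j : \sum_l invmx (g p) i l * g p j l = (i == j)%:R.
  by rewrite -ig; apply: eq_bigr => l _; rewrite gC.
apply/matrixP => k j; rewrite !mxE.
transitivity (\sum_i ((\sum_l invmx (g p) i l * g p i l) * P j k
   + g p j k * (\sum_l invmx (g p) i l * P i l)
   - (\sum_l invmx (g p) i l * g p j l) * P i k
   - (\sum_l invmx (g p) i l * P j l) * g p i k)).
  apply: eq_bigr => i _; rewrite riemE !mulr_suml mulr_sumr.
  by rewrite -big_split -!sumrB; apply: eq_bigr => l _ /=; ring.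
rewrite !sumrB big_split /= -mulr_suml -mulr_sumr.
have -> : \sum_i \sum_l invmx (g p) i l * g p i l = n%:R.
  rewrite -[n in RHS]card_ord -sumr_const.
  by apply: eq_bigr => i _; rewrite ig' eqxx.
have -> : \sum_i (\sum_l invmx (g p) i l * g p j l) * P i k = P j k.
  rewrite (bigD1 j)//= ig' eqxx mul1r big1 ?addr0// => i ij.
  by rewrite ig' (negbTE ij) mul0r.
have -> : \sum_i (\sum_l invmx (g p) i l * P j l) * g p i k = P j k.
  have gi l : \sum_i invmx (g p) i l * g p i k = (k == l)%:R.
    have /matrixP/(_ k l) := mulmxV gu; rewrite !mxE => <-.
    by apply: eq_bigr => i _; rewrite gC mulrC.
  under eq_bigr do rewrite mulr_suml.
  rewrite exchange_big (bigD1 k)//= [X in _ + X]big1 ?addr0 => [|l lk].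
    under eq_bigr do rewrite mulrAC.
    by rewrite -mulr_suml gi eqxx mul1r.
  under eq_bigr do rewrite mulrAC.
  by rewrite -mulr_suml gi eq_sym (negbTE lk) mul0r.
rewrite (PC j) (gC j) -/t; ring.
Qed.

Lemma schouten_scalar_curvature : scalar_curvature g p = (2 * n%:R - 2) * t.
Proof.
have tr := sum_invmx_tr gu gC.
rewrite /scalar_curvature schouten_ricci.
transitivity ((n%:R - 2) * t + t * n%:R); last by ring.
rewrite -tr !mulr_sumr -big_split; apply: eq_bigr => i _ /=.
rewrite !mulr_sumr -big_split; apply: eq_bigr => j _ /=.
by rewrite !mxE; ring.
Qed.

(** Since Ric = (n - 2) P + t g and the scalar curvature is 2 (n - 1) t, the trace terms subtracted
    in [weyl] add up to the Kulkarni-Nomizu product itself; n > 2 keeps the denominators nonzero. *)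
Lemma schouten_weyl l k i j : (2 < n)%N -> weyl g l k i j p = 0.
Proof.
move=> n2; rewrite /weyl curv schouten_scalar_curvature schouten_ricci !mxE.
have n2' : n%:R - 2 != 0 :> R by rewrite subr_eq0 eqr_nat gtn_eqF.
have n1' : n%:R - 1 != 0 :> R by rewrite subr_eq0 (eqr_nat _ _ 1) gtn_eqF// ltnW.
move: (g p i l) (g p j k) (g p i k) (g p j l) => a b c d.
by field; rewrite n2' n1'.
Qed.

End SchoutenForm.

Lemma flat_riemann (R : realType) n (g : 'rV[R]_n -> 'M[R]_n) p m k i j :
  g p \in unitmx -> (forall l, \sum_m g p l m * riemann g m k i j p = 0) ->
  riemann g m k i j p = 0.
Proof.
move=> gu g0; have : (invmx (g p) *m (g p *m \col_m riemann g m k i j p)) m 0 =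
    riemann g m k i j p by rewrite mulmxA mulVmx// mul1mx mxE.
move=> <-; rewrite mxE big1// => l _; rewrite mxE.
under eq_bigr do rewrite mxE.
by rewrite g0 mulr0.
Qed.

(** * Sections of the null cone and their rescalings *)

Section ConeCurvature.
Context {R : realType} {n : nat}.
Variables (h : 'I_(2 + n) -> R) (U : set 'rV[R]_n).
Variables (X : 'I_(2 + n) -> 'rV[R]_n -> R) (g : 'rV[R]_n -> 'M[R]_n).
Hypotheses (oU : open U) (eX : forall k, elem U (X k)).
Hypothesis gu : forall p, U p -> g p \in unitmx.
Hypothesis XX : forall p, U p -> ip h (X^~ p) (X^~ p) = 0.

Lemma cone_weyl (N : 'I_(2 + n) -> 'rV[R]_n -> R) :
  (2 < n)%N ->
  (forall p, U p -> ip h (X^~ p) (N^~ p) = 1) ->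
  (forall p, U p -> ip h (N^~ p) (N^~ p) = 0) ->
  (forall p i, U p -> ip h (N^~ p) (fun k => partial i (X k) p) = 0) ->
  (forall p i j, U p ->
    ip h (fun k => partial i (X k) p) (fun k => partial j (X k) p) = g p i j) ->
  weyl_vanishes U g.
Proof.
move=> n2 XN NN ND DD p Up l k i j.
pose P := \matrix_(a, b) schouten h X N p a b.
apply: (@schouten_weyl _ _ _ _ P (gu Up)) => // [a b|a b|l' k' a b].
- exact: (cone_sym DD).
- by rewrite !mxE; exact: (schoutenC _ _ oU eX).
- rewrite !mxE; exact: (gauss_cone oU eX gu XX XN NN ND DD).
Qed.

(* X / <X, v> is another section of the cone; its null partner N is chosen so
   that -<d^2 (X / <X, v>), N> is a multiple of the metric. *)
Section Rescale.
Variable v : 'I_(2 + n) -> R.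
Let u p := ip h v (X^~ p).
Hypothesis u0 : forall p, U p -> u p != 0.
Hypothesis DD : forall p i j, U p -> g p i j = (u p)^-1 ^+ 2 *
  ip h (fun k => partial i (X k) p) (fun k => partial j (X k) p).

#[local] Opaque ip partial.

Let X' k p := (u p)^-1 * X k p.
(** As <v, X'> = 1, adding c X' to [v] changes its square by 2 c; this value of c makes the result
    null and leaves its product with X' equal to 1. *)
Let N' k p := v k + - (ip h v v / 2) * X' k p.

Let eu : elem U u.
Proof. by apply: (elem_ip h (A := fun k => fun=> v k)) => // k; exact: elem_cst. Qed.

Let eX' k : elem U (X' k).
Proof. by apply: elemM => //; exact: elemV. Qed.

Let du p : U p -> differentiable (fun q => (u q)^-1) p.
Proof. by move=> Up; exact: (elem_differentiable oU (elemV eu u0) Up). Qed.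

Let DX' i k p : U p -> partial i (X' k) p =
  (u p)^-1 * partial i (X k) p + partial i (fun q => (u q)^-1) p * X k p.
Proof.
move=> Up; rewrite partialM; [by rewrite addrC|exact: du|].
exact: (elem_differentiable oU (eX k) Up).
Qed.

Let XD i p : U p -> ip h (X^~ p) (fun k => partial i (X k) p) = 0.
Proof.
move=> Up; have := partial_cst 0 p i.
rewrite -(partial_eq_on i oU Up XX) partial_ip => [|k|k];
  [|exact: (elem_differentiable oU (eX k) Up)..].
by rewrite (ipC _ _ (X^~ p)) -mulr2n => /eqP; rewrite mulrn_eq0/= => /eqP.
Qed.

Let XX' p : U p -> ip h (X'^~ p) (X'^~ p) = 0.
Proof. by move=> Up; rewrite ipZr ipZl XX// !mulr0. Qed.

Let vX' p : U p -> ip h v (X'^~ p) = 1.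
Proof. by move=> Up; rewrite ipZr mulVf// u0. Qed.

Let XN' p : U p -> ip h (X'^~ p) (N'^~ p) = 1.
Proof. by move=> Up; rewrite ipDr ipZr XX'// mulr0 addr0 ipC vX'. Qed.

Let NN' p : U p -> ip h (N'^~ p) (N'^~ p) = 0.
Proof.
move=> Up; rewrite ipDl ipZl XN'// ipDr ipZr vX'//; by field.
Qed.

Let XD' p i : U p -> ip h (X'^~ p) (fun k => partial i (X' k) p) = 0.
Proof.
move=> Up; have := partial_cst 0 p i.
rewrite -(partial_eq_on i oU Up XX') partial_ip => [|k|k];
  [|exact: (elem_differentiable oU (eX' k) Up)..].
by rewrite (ipC _ _ (X'^~ p)) -mulr2n => /eqP; rewrite mulrn_eq0/= => /eqP.
Qed.

Let vD' p i : U p -> ip h v (fun k => partial i (X' k) p) = 0.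
Proof.
move=> Up; have := partial_cst 1 p i.
rewrite -(partial_eq_on i oU Up vX').
by rewrite partial_ip_cst// => k; exact: (elem_differentiable oU (eX' k) Up).
Qed.

Let ND' p i : U p -> ip h (N'^~ p) (fun k => partial i (X' k) p) = 0.
Proof. by move=> Up; rewrite ipDl ipZl XD'// vD'// mulr0 addr0. Qed.

Let DD' p i j : U p ->
  ip h (fun k => partial i (X' k) p) (fun k => partial j (X' k) p) = g p i j.
Proof.
move=> Up; rewrite DD//.
rewrite (eq_ip h (fun k => DX' i k Up) (fun k => DX' j k Up)).
rewrite ipDl !ipDr !ipZl !ipZr (XX Up) (XD j Up) (ipC h _ (X^~ p)) (XD i Up).
by rewrite !mulr0 !addr0 expr2 mulrA.
Qed.

(** Since <v, X'> is constant, [v] is orthogonal to all second derivatives of X'; only the X' part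
    of N' contributes, through [cone_second]. *)
Lemma schouten_rescale p i j : U p ->
  schouten h X' N' p i j = - (ip h v v / 2) * g p i j.
Proof.
move=> Up; rewrite /schouten ipC ipDl ipZl.
rewrite (cone_second oU eX' XX' DD' i j Up).
have -> : ip h v (fun k => partial i (partial j (X' k)) p) = 0.
  have := partial_cst 0 p i; rewrite -(partial_eq_on i oU Up (fun q => @vD' q j)).
  rewrite partial_ip_cst// => k.
  by apply: (elem_differentiable oU (elem_partial oU j (eX' k)) Up).
by rewrite add0r mulrN opprK.
Qed.

(** X' takes values in the hyperplane section <x, v> = 1 of the cone, which has constant curvature -
    <v, v>. *)
Lemma gauss_rescale p l k i j : U p ->
  \sum_m g p l m * riemann g m k i j p =
  - ip h v v * (g p i l * g p j k - g p j l * g p i k).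
Proof.
move=> Up; rewrite (gauss_cone oU eX' gu XX' XN' NN' ND' DD')//.
rewrite !schouten_rescale//; by field.
Qed.

Lemma riemann_rescale_flat p l k i j : ip h v v = 0 -> U p ->
  riemann g l k i j p = 0.
Proof.
move=> vv Up; apply: flat_riemann; first exact: gu.
by move=> r; rewrite gauss_rescale// vv oppr0 mul0r.
Qed.

Lemma ricci_rescale p : U p ->
  ricci g p = (- (n%:R - 1) * ip h v v) *: g p.
Proof.
move=> Up; have gC : forall i j, g p i j = g p j i.
  by move=> i j; exact: (cone_sym DD' i j Up).
rewrite (schouten_ricci (P := (- (ip h v v / 2)) *: g p) (gu Up) gC).
- set t := \sum_i _.
  have -> : t = - (ip h v v / 2) * n%:R.
    rewrite -(sum_invmx_tr (gu Up) gC) mulr_sumr; apply: eq_bigr => i _.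
    rewrite mulr_sumr; apply: eq_bigr => j _; rewrite !mxE mulrCA//.
  rewrite scalerA -scalerDl; congr (_ *: _); by field.
- by move=> i j; rewrite !mxE gC.
- by move=> l k i j; rewrite gauss_rescale// !mxE; field.
Qed.

End Rescale.
End ConeCurvature.

(** * The real Pfaffian forms and the embedding *)

Lemma ord5P (P : 'I_5 -> Prop) :
  P i_z -> P i_theta -> P i_phi -> P i_x -> P i_q -> forall i, P i.
Proof.
move=> P0 P1 P2 P3 P4 i.
case: i => [[|[|[|[|[|//]]]]] hi].
- by rewrite (_ : Ordinal hi = i_z)//; exact: val_inj.
- by rewrite (_ : Ordinal hi = i_theta)//; exact: val_inj.
- by rewrite (_ : Ordinal hi = i_phi)//; exact: val_inj.
- by rewrite (_ : Ordinal hi = i_x)//; exact: val_inj.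
- by rewrite (_ : Ordinal hi = i_q)//; exact: val_inj.
Qed.

Lemma sum_ord5 (V : zmodType) (F : 'I_5 -> V) :
  \sum_i F i = F i_z + F i_theta + F i_phi + F i_x + F i_q.
Proof.
rewrite !big_ord_recr big_ord0 /= add0r.
by congr (F _ + F _ + F _ + F _ + F _); exact: val_inj.
Qed.

Section Forms.
Context {R : realType}.
Implicit Types (a : R) (p : 'rV[R]_5).

(** [pfaffA] and [pfaffB] are the real and imaginary parts of [eta1], and [pfaffE] is [eta3] before
    complexification. *)
Definition pfaffA a p : 'rV[R]_5 := sigma2 p + a *: dx.
Definition pfaffB a p : 'rV[R]_5 := sigma1 p - (a * sin (cx p)) *: dq.
Definition pfaffE p : 'rV[R]_5 :=
  - dz - cos (ctheta p) *: dphi + cos (cx p) *: dq.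

Lemma pfaffAE a p (i : 'I_5) :
  pfaffA a p 0 i = [:: 0; cos (cz p); sin (cz p) * sin (ctheta p); a; 0]`_i.
Proof. by elim/ord5P: i; rewrite !mxE /=; ring. Qed.

Lemma pfaffBE a p (i : 'I_5) : pfaffB a p 0 i =
  [:: 0; sin (cz p); - (cos (cz p) * sin (ctheta p)); 0; - (a * sin (cx p))]`_i.
Proof. by elim/ord5P: i; rewrite !mxE /=; ring. Qed.

Lemma pfaffEE p (i : 'I_5) :
  pfaffE p 0 i = [:: -1; 0; - cos (ctheta p); 0; cos (cx p)]`_i.
Proof. by elim/ord5P: i; rewrite !mxE /=; ring. Qed.

End Forms.

(* [coneY] is the product of two elements of SU(2) given by Euler angles, read
   as a unit vector of R^4 (up to an isometry of R^4); [conen] is the unit vector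
   of R^3 with spherical coordinates t and f. *)
Section Embedding.
Context {R : realType}.
Variable eps : R.
Hypothesis eps2 : eps ^+ 2 = 1.

Lemma eps_cases : eps = 1 \/ eps = -1.
Proof.
by move/eqP: eps2; rewrite sqrf_eq1 => /orP[]/eqP->; [left|right].
Qed.

Definition ehalf (i : 'I_5) (a : R) (j : 'I_5) : expr R 5 :=
  EMul (ECst 2^-1) (EAdd (EVar i) (EMul (ECst a) (EVar j))).

Local Notation eb := (ehalf i_phi (-1) i_q).
Local Notation ec := (ehalf i_phi 1 i_q).
Local Notation eu := (ehalf i_theta eps i_x).
Local Notation ev := (ehalf i_theta (- eps) i_x).
Local Notation ek := (EMul (ECst 2^-1) (EVar i_z)).

Definition coneY : seq (expr R 5) :=
  [:: EAdd (EMul (ECos eb) (EMul (ECos eu) (ECos ek)))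
           (EMul (ECst (-1)) (EMul (ESin eb) (EMul (ECos ev) (ESin ek))));
      EAdd (EMul (ESin eb) (EMul (ECos eu) (ECos ek)))
           (EMul (ECos eb) (EMul (ECos ev) (ESin ek)));
      EAdd (EMul (ECos ec) (EMul (ESin eu) (ECos ek)))
           (EMul (ESin ec) (EMul (ESin ev) (ESin ek)));
      EAdd (EMul (ESin ec) (EMul (ESin eu) (ECos ek)))
           (EMul (ECst (-1)) (EMul (ECos ec) (EMul (ESin ev) (ESin ek))))].

Definition conen (t f : 'I_5) : seq (expr R 5) :=
  [:: ECos (EVar t); EMul (ESin (EVar t)) (ECos (EVar f));
      EMul (ESin (EVar t)) (ESin (EVar f))].

(** In half-angles both sides are polynomials in the sines and cosines of five angles, equal modulo
    the Pythagorean relations and eps^2 = 1. The case split on eps only serves to take the sign out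
    of the sine and cosine of x; the factor 1/4 is the square of the half in the half-angles. *)
Lemma coneY_gram (p : 'rV[R]_5) (i j : 'I_5) :
  \sum_(e <- coneY) eeval (ederiv i e) p * eeval (ederiv j e) p =
  4^-1 * (pfaffA eps p 0 i * pfaffA eps p 0 j + pfaffB eps p 0 i * pfaffB eps p 0 j
          + pfaffE p 0 i * pfaffE p 0 j).
Proof.
rewrite !pfaffAE !pfaffBE !pfaffEE /cz /ctheta /cx !big_cons big_nil.
set b := 2^-1 * (p 0 i_phi + -1 * p 0 i_q).
set c := 2^-1 * (p 0 i_phi + 1 * p 0 i_q).
set u := 2^-1 * (p 0 i_theta + eps * p 0 i_x).
set v := 2^-1 * (p 0 i_theta + - eps * p 0 i_x).
set k := 2^-1 * p 0 i_z.
have zE : p 0 i_z = k + k by rewrite /k; field.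
have tE : p 0 i_theta = u + v by rewrite /u /v; field.
have xE : p 0 i_x = eps * u - eps * v.
  have -> : eps * u - eps * v = eps ^+ 2 * p 0 i_x by rewrite /u /v; field.
  by rewrite eps2 mul1r.
have cxE : cos (p 0 i_x) = cos u * cos v + sin u * sin v.
  rewrite xE; case: eps_cases => ->; rewrite ?mul1r ?mulN1r.
    by rewrite cosD cosN sinN; ring.
  by rewrite opprK cosD cosN sinN; ring.
have sxE : sin (p 0 i_x) = eps * (sin u * cos v - cos u * sin v).
  rewrite xE; case: eps_cases => ->; rewrite ?mul1r ?mulN1r.
    by rewrite sinD cosN sinN; ring.
  by rewrite opprK sinD cosN sinN; ring.
rewrite cxE sxE zE tE !cosD !sinD.
have hb : cos b ^+ 2 = 1 - sin b ^+ 2 by rewrite -(cos2Dsin2 b) addrK.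
have hc : cos c ^+ 2 = 1 - sin c ^+ 2 by rewrite -(cos2Dsin2 c) addrK.
have hu : cos u ^+ 2 = 1 - sin u ^+ 2 by rewrite -(cos2Dsin2 u) addrK.
have hv : cos v ^+ 2 = 1 - sin v ^+ 2 by rewrite -(cos2Dsin2 v) addrK.
have hk : cos k ^+ 2 = 1 - sin k ^+ 2 by rewrite -(cos2Dsin2 k) addrK.
elim/ord5P: i; elim/ord5P: j => /=; rewrite -/b -/c -/u -/v -/k.
all: move: (cos b) (sin b) (cos c) (sin c) (cos u) (sin u) (cos v) (sin v)
       (cos k) (sin k) hb hc hu hv hk.
all: move=> cb sb cc sc cu su cv sv ck sk hb hc hu hv hk.
all: by field: eps2 hb hc hu hv hk.
Qed.

End Embedding.

(** * The complex forms and metrics in real terms *)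

(** Collects the real and imaginary parts of [eta1]: here x is the imaginary unit, y is alpha and z
    is the sine of the coordinate x. *)
Lemma eta_rearrange (K : fieldType) (V : lmodType K) (x y z : K) (a b c d : V) :
  b + x *: a + y *: (c - (x * z) *: d) =
  b + y *: c + x *: (a - (y * z) *: d).
Proof. by rewrite !scalerBr !scalerA addrACA (mulrCA y). Qed.

Lemma eta_rearrangeN (K : fieldType) (V : lmodType K) (x y z : K)
    (a b c d : V) :
  b - x *: a + y *: (c + (x * z) *: d) =
  b + y *: c - x *: (a - (y * z) *: d).
Proof.
by have := eta_rearrange (- x) y z a b c d; rewrite mulNr !scaleNr opprK.
Qed.

Section RealForms.
Context {R : realType}.
Implicit Types (a b : 'rV[R]_5) (alpha : R) (p : 'rV[R]_5).

Definition sqform a : 'M[R]_5 := a^T *m a.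

Lemma sqformE a i j : sqform a i j = a 0 i * a 0 j.
Proof. by rewrite mxE big_ord1 mxE. Qed.

Lemma symprod_conj a b :
  symprod (toC a + 'i%C *: toC b) (toC a - 'i%C *: toC b) =
  toC (sqform a + sqform b).
Proof.
apply/matrixP => i j; rewrite /symprod !mxE !big_ord1 !mxE.
rewrite !(rmorphD, rmorphM) /=.
have h : ('i%C : R[i]) ^+ 2 = -1 := sqr_i R.
by field: h.
Qed.

Lemma symprodZ (K : fieldType) n (c d : K) (a b : 'rV[K]_n) :
  symprod (c *: a) (d *: b) = (c * d) *: symprod a b.
Proof. by apply/matrixP => i j; rewrite /symprod !mxE !big_ord1 !mxE; ring. Qed.

Lemma symprodC (K : fieldType) n (a b : 'rV[K]_n) : symprod a b = symprod b a.
Proof. by rewrite /symprod addrC. Qed.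

Lemma expiN (t : R) : expi t * expi (- t) = 1.
Proof.
rewrite /expi cosN sinN; apply/eqP; rewrite eq_complex /=.
by rewrite mulrN opprK -!expr2 cos2Dsin2 eqxx mulrN mulrC addNr eqxx.
Qed.

Lemma toCD m n (A B : 'M[R]_(m, n)) : toC (A + B) = toC A + toC B.
Proof. exact: map_mxD. Qed.

Lemma toCN m n (A : 'M[R]_(m, n)) : toC (- A) = - toC A.
Proof. exact: map_mxN. Qed.

Lemma toCZ m n (c : R) (A : 'M[R]_(m, n)) : toC (c *: A) = c%:C%C *: toC A.
Proof. exact: map_mxZ. Qed.

Lemma toC_natZ m n k (A : 'M[R]_(m, n)) : toC (k%:R *: A) = k%:R *: toC A.
Proof. by rewrite /toC map_mxZ rmorph_nat. Qed.

Lemma eta1_real alpha p :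
  eta1 alpha p = toC (pfaffA alpha p) + 'i%C *: toC (pfaffB alpha p).
Proof.
rewrite /eta1 /pfaffA /pfaffB; move: (sigma1 p) (sigma2 p) dx dq => a b c d.
rewrite !toCD toCN !toCZ rmorphM; exact: eta_rearrange.
Qed.

Lemma eta2_real alpha p :
  eta2 alpha p = toC (pfaffA alpha p) - 'i%C *: toC (pfaffB alpha p).
Proof.
rewrite /eta2 /pfaffA /pfaffB; move: (sigma1 p) (sigma2 p) dx dq => a b c d.
rewrite !toCD toCN !toCZ rmorphM; exact: eta_rearrangeN.
Qed.

Lemma eta3_real p : eta3 p = toC (pfaffE p).
Proof. by []. Qed.

Definition sphere_metric (t : R) a b : 'M[R]_5 :=
  sqform a + sqform (sin t *: b).

(** The phases of the two factors cancel, leaving the squared modulus of d theta - i sin theta d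
    phi, the round metric of the 2-sphere. *)
Lemma symprod_tau12 p : symprod (tau1 p) (tau2 p) =
  toC (sphere_metric (ctheta p) dtheta dphi).
Proof.
rewrite symprodZ expiN scale1r symprodC -symprod_conj.
by rewrite [toC (_ *: _)]map_mxZ scalerA.
Qed.

Lemma symprod_tau45 p : symprod (tau4 p) (tau5 p) =
  toC (sphere_metric (cx p) dx dq).
Proof.
rewrite symprodZ expiN scale1r symprodC -symprod_conj.
by rewrite [toC (_ *: _)]map_mxZ scalerA.
Qed.

Lemma symprod_toC a : symprod (toC a) (toC a) = toC (sqform a).
Proof.
apply/matrixP => i j; rewrite /symprod !mxE !big_ord1 !mxE rmorphM /=.
by field.
Qed.

Lemma toC_Re (M : 'M[R]_5) : map_mx (@complex.Re R) (toC M) = M.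
Proof. by apply/matrixP => i j; rewrite !mxE. Qed.

Lemma metric_thirdC_real alpha p : metric_thirdC alpha p =
  toC (9 *: (sqform (pfaffA alpha p) + sqform (pfaffB alpha p))
       + 3 *: sqform (pfaffE p) - 18 *: sphere_metric (ctheta p) dtheta dphi
       + 2 *: sphere_metric (cx p) dx dq).
Proof.
have E (A B C D : 'M[R]_5) A' B' C' D' : A' = toC A -> B' = toC B ->
    C' = toC C -> D' = toC D -> 9 *: A' + 3 *: B' - 18 *: C' + 2 *: D' =
    toC (9 *: A + 3 *: B - 18 *: C + 2 *: D).
  by move=> -> -> -> ->; rewrite !(toCD, toCN) !toC_natZ.
apply: E; [|exact: symprod_toC|exact: symprod_tau12|exact: symprod_tau45].
by rewrite eta1_real eta2_real symprod_conj.
Qed.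

Lemma metric_threeC_real alpha p : metric_threeC alpha p =
  toC (sqform (pfaffA alpha p) + sqform (pfaffB alpha p)
       + 3 *: sqform (pfaffE p) + 2 *: sphere_metric (ctheta p) dtheta dphi
       - 18 *: sphere_metric (cx p) dx dq).
Proof.
have E (A B C D : 'M[R]_5) A' B' C' D' : A' = toC A -> B' = toC B ->
    C' = toC C -> D' = toC D -> A' + 3 *: B' + 2 *: C' - 18 *: D' =
    toC (A + 3 *: B + 2 *: C - 18 *: D).
  by move=> -> -> -> ->; rewrite !(toCD, toCN) !toC_natZ.
apply: E; [|exact: symprod_toC|exact: symprod_tau12|exact: symprod_tau45].
by rewrite eta1_real eta2_real symprod_conj.
Qed.

(* [b] tells which of the two 2-spheres carries the unit vector of R^3: it is
   [true] for alpha = eps / 3 and [false] for alpha = 3 eps. *)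
Definition cone_metric (b : bool) (eps : R) p : 'M[R]_5 :=
  3 *: (sqform (pfaffA eps p) + sqform (pfaffB eps p) + sqform (pfaffE p))
  - 12 *: (if b then sphere_metric (ctheta p) dtheta dphi
           else sphere_metric (cx p) dx dq).

Lemma cone_metricE (b : bool) (eps : R) p (i j : 'I_5) : cone_metric b eps p i j =
  3 * (pfaffA eps p 0 i * pfaffA eps p 0 j + pfaffB eps p 0 i * pfaffB eps p 0 j
       + pfaffE p 0 i * pfaffE p 0 j)
  - 12 * (if b then (i == i_theta)%:R * (j == i_theta)%:R
            + sin (ctheta p) ^+ 2 * ((i == i_phi)%:R * (j == i_phi)%:R)
          else (i == i_x)%:R * (j == i_x)%:R
            + sin (cx p) ^+ 2 * ((i == i_q)%:R * (j == i_q)%:R)).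
Proof.
rewrite -!sqformE /cone_metric; move: (sqform _) (sqform _) (sqform _) => A B E.
by case: b; rewrite /sphere_metric !mxE !big_ord1 !mxE /=; ring.
Qed.

(** Completing the square, with s = sigma_2 + i sigma_1 and t = dx - i sin x dq: 9 |s + (eps / 3)
    t|^2 - 18 |s|^2 + 2 |t|^2 = 3 |s + eps t|^2 - 12 |s|^2. *)
Lemma metric_third_cone eps p : eps ^+ 2 = 1 ->
  metric_third (eps / 3) p = cone_metric true eps p.
Proof.
move=> e2; rewrite /metric_third metric_thirdC_real toC_Re.
apply/matrixP => i j; rewrite !mxE !big_ord1 !mxE /=.
have hz : cos (cz p) ^+ 2 = 1 - sin (cz p) ^+ 2.
  by rewrite -(cos2Dsin2 (cz p)) addrK.
move: (cos (cz p)) (sin (cz p)) (cos (ctheta p)) (sin (ctheta p)) hz.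
move: (cos (cx p)) (sin (cx p)) => cx sx c s ct st hz.
(* With the Kronecker symbols as variables, one identity of bilinear forms covers all 25 entries. *)
move: (i == i_z)%:R (j == i_z)%:R (i == i_theta)%:R (j == i_theta)%:R.
move: (i == i_phi)%:R (j == i_phi)%:R (i == i_x)%:R (j == i_x)%:R.
move: (i == i_q)%:R (j == i_q)%:R.
move=> y1 y2 y3 y4 y5 y6 y7 y8 y9 y10; by field: e2 hz.
Qed.

(** The same completion with the spheres exchanged: |s + 3 eps t|^2 + 2 |s|^2 - 18 |t|^2 = 3 |s +
    eps t|^2 - 12 |t|^2. *)
Lemma metric_three_cone eps p : eps ^+ 2 = 1 ->
  metric_three (eps * 3) p = cone_metric false eps p.
Proof.
move=> e2; rewrite /metric_three metric_threeC_real toC_Re.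
apply/matrixP => i j; rewrite !mxE !big_ord1 !mxE /=.
have hz : cos (cz p) ^+ 2 = 1 - sin (cz p) ^+ 2.
  by rewrite -(cos2Dsin2 (cz p)) addrK.
move: (cos (cz p)) (sin (cz p)) (cos (ctheta p)) (sin (ctheta p)) hz.
move: (cos (cx p)) (sin (cx p)) => cx sx c s ct st hz.
move: (i == i_z)%:R (j == i_z)%:R (i == i_theta)%:R (j == i_theta)%:R.
move: (i == i_phi)%:R (j == i_phi)%:R (i == i_x)%:R (j == i_x)%:R.
move: (i == i_q)%:R (j == i_q)%:R.
move=> y1 y2 y3 y4 y5 y6 y7 y8 y9 y10; by field: e2 hz.
Qed.

End RealForms.

(** * Cartan's structure equations *)

Section Coframe.
Context {R : realType}.
Variables alpha k lam u v : R.
Implicit Types (p : 'rV[R]_5) (i j : 'I_5).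

Local Notation EZ := (EVar i_z).
Local Notation ET := (EVar i_theta).
Local Notation EX := (EVar i_x).
Local Notation "a =? b" := (ECst (a == b)%:R) (at level 70).

(** The index stays symbolic: Kronecker symbols are constants of the expression, so all components
    are differentiated at once. *)
Definition expr_pfaffA j : expr R 5 :=
  EAdd (EMul (ECos EZ) (j =? i_theta))
    (EAdd (EMul (EMul (ESin EZ) (ESin ET)) (j =? i_phi))
          (EMul (ECst alpha) (j =? i_x))).

Definition expr_pfaffB j : expr R 5 :=
  EAdd (EMul (ESin EZ) (j =? i_theta))
    (EAdd (EMul (EMul (EMul (ECst (-1)) (ECos EZ)) (ESin ET)) (j =? i_phi))
          (EMul (EMul (ECst (- alpha)) (ESin EX)) (j =? i_q))).

Definition expr_pfaffE j : expr R 5 :=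
  EAdd (EMul (ECst (-1)) (j =? i_z))
    (EAdd (EMul (EMul (ECst (-1)) (ECos ET)) (j =? i_phi))
          (EMul (ECos EX) (j =? i_q))).

Definition expr_pfaffF j : expr R 5 := EMul (ESin EX) (j =? i_q).

Definition pfaffF p : 'rV[R]_5 := sin (cx p) *: dq.
(** Up to sign, the connection form of the round 2-sphere with coframe dx, sin x dq; it carries the
    part of the structure equations whose coefficients are not constant, and is absorbed in
    Omega_2. *)
Definition pfaffC p : 'rV[R]_5 := cos (cx p) *: dq.

Lemma expr_pfaffAE p j : pfaffA alpha p 0 j = eeval (expr_pfaffA j) p.
Proof. by rewrite !mxE /=; ring. Qed.

Lemma expr_pfaffBE p j : pfaffB alpha p 0 j = eeval (expr_pfaffB j) p.
Proof. by rewrite !mxE /=; ring. Qed.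

Lemma expr_pfaffEE p j : pfaffE p 0 j = eeval (expr_pfaffE j) p.
Proof. by rewrite !mxE /=; ring. Qed.

Lemma expr_pfaffFE p j : pfaffF p 0 j = eeval (expr_pfaffF j) p.
Proof. by rewrite !mxE. Qed.

Lemma ext_deriv_expr (w : 'rV[R]_5 -> 'rV[R]_5) (e : 'I_5 -> expr R 5) p i j :
  (forall q l, w q 0 l = eeval (e l) q) -> (forall l, ewd (e l) p) ->
  ext_deriv w p i j = eeval (ederiv i (e j)) p - eeval (ederiv j (e i)) p.
Proof.
move=> we wd; rewrite mxE.
have E l : (fun q => w q 0 l) = eeval (e l) by apply/funext => q; exact: we.
by rewrite !E !(eeval_diff (wd _)).2.
Qed.

Lemma ext_deriv_pfaffA p : ext_deriv (pfaffA alpha) p =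
  wedge (pfaffE p - pfaffC p) (pfaffB alpha p) + alpha *: wedge (pfaffE p) (pfaffF p).
Proof.
apply/matrixP => i j; rewrite (ext_deriv_expr _ _ expr_pfaffAE)//.
rewrite /wedge !mxE !big_ord1 !mxE /= /cz /ctheta /cx.
have hz : cos (p 0 i_z) ^+ 2 = 1 - sin (p 0 i_z) ^+ 2.
  by rewrite -(cos2Dsin2 (p 0 i_z)) addrK.
by ring: hz.
Qed.

Lemma ext_deriv_pfaffB p : ext_deriv (pfaffB alpha) p =
  - wedge (pfaffE p - pfaffC p) (pfaffA alpha p) + alpha *: wedge (pfaffE p) dx.
Proof.
apply/matrixP => i j; rewrite (ext_deriv_expr _ _ expr_pfaffBE)//.
rewrite /wedge !mxE !big_ord1 !mxE /= /cz /ctheta /cx.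
have hz : cos (p 0 i_z) ^+ 2 = 1 - sin (p 0 i_z) ^+ 2.
  by rewrite -(cos2Dsin2 (p 0 i_z)) addrK.
by ring: hz.
Qed.

Lemma ext_deriv_pfaffE p : ext_deriv pfaffE p =
  wedge (pfaffB alpha p) (pfaffA alpha p) - alpha *: wedge (pfaffB alpha p) dx
  + alpha *: wedge (pfaffF p) (pfaffA alpha p)
  + (alpha ^+ 2 - 1) *: wedge dx (pfaffF p).
Proof.
apply/matrixP => i j; rewrite (ext_deriv_expr _ _ expr_pfaffEE)//.
rewrite /wedge !mxE !big_ord1 !mxE /= /cz /ctheta /cx.
have hz : cos (p 0 i_z) ^+ 2 = 1 - sin (p 0 i_z) ^+ 2.
  by rewrite -(cos2Dsin2 (p 0 i_z)) addrK.
by ring: hz.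
Qed.

Lemma ext_deriv_pfaffF p : ext_deriv pfaffF p = wedge dx (pfaffC p).
Proof.
apply/matrixP => i j; rewrite (ext_deriv_expr _ _ expr_pfaffFE)//.
rewrite /wedge !mxE !big_ord1 !mxE /= /cz /ctheta /cx.
have hz : cos (p 0 i_z) ^+ 2 = 1 - sin (p 0 i_z) ^+ 2.
  by rewrite -(cos2Dsin2 (p 0 i_z)) addrK.
by ring: hz.
Qed.

Lemma ext_deriv_dx p : ext_deriv (fun=> dx) p = 0.
Proof. by apply/matrixP => i j; rewrite !mxE !partial_cst subrr. Qed.

Lemma ext_derivD (w w' : 'rV[R]_5 -> 'rV[R]_5) p :
  (forall j, differentiable (fun q => w q 0 j) p) ->
  (forall j, differentiable (fun q => w' q 0 j) p) ->
  ext_deriv (fun q => w q + w' q) p = ext_deriv w p + ext_deriv w' p.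
Proof.
move=> dw dw'; apply/matrixP => i j; rewrite !mxE.
have E l : (fun q => (w q + w' q) 0 l) = fun q => w q 0 l + w' q 0 l.
  by apply/funext => q; rewrite mxE.
by rewrite !E !partialD// addrACA opprD.
Qed.

Lemma ext_derivZ (w : 'rV[R]_5 -> 'rV[R]_5) (c : R) p :
  (forall j, differentiable (fun q => w q 0 j) p) ->
  ext_deriv (fun q => c *: w q) p = c *: ext_deriv w p.
Proof.
move=> dw; apply/matrixP => i j; rewrite !mxE.
have E l : (fun q => (c *: w q) 0 l) = fun q => c * w q 0 l.
  by apply/funext => q; rewrite mxE.
have dc : differentiable (fun=> c : R) p by exact: differentiable_cst.
by rewrite !E !partialM// !partial_cst !mul0r !add0r mulrBr.
Qed.

(** A complex-linear ansatz: theta_1 + i theta_2 = k eta_1 and theta_5 - i theta_4 = u eta_1 + v (dx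
    - i sin x dq). Then theta_1 theta_5 - theta_2 theta_4 is the real part of the first times the
    conjugate of the second. *)
Definition cofr1 p := k *: pfaffA alpha p.
Definition cofr2 p := k *: pfaffB alpha p.
Definition cofr3 p := lam *: pfaffE p.
Definition cofr4 p := - u *: pfaffB alpha p + v *: pfaffF p.
Definition cofr5 p : 'rV[R]_5 := u *: pfaffA alpha p + v *: dx.

(** Read off from d theta_1: comparing the terms in B gives Omega_2 = C - (1 + lam u / k) E for the
    forms [pfaffB], [pfaffC], [pfaffE]. *)
Let mu := - lam^-1 - u / k.
Definition conn2 p := mu *: cofr3 p + pfaffC p.

(* With this ansatz, Cartan's equations become polynomial equations in the
   constants; these are their solutions for alpha = eps / 3 and alpha = 3 eps. *)
Variable eps : R.
Hypothesis eps2 : eps ^+ 2 = 1.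
Hypothesis params :
  [/\ alpha = eps / 3, k = 1, lam = 2^-1, u = - 2^-1 & v = 2 / 3 * eps] \/
  [/\ alpha = eps * 3, k = 3^-1, lam = - 2^-1, u = 2^-1 & v = - (2 * eps)].

Let dexpr (w : 'rV[R]_5 -> 'rV[R]_5) (e : 'I_5 -> expr R 5) p :
  (forall q l, w q 0 l = eeval (e l) q) -> (forall l, ewd (e l) p) ->
  forall j, differentiable (fun q => w q 0 j) p.
Proof.
move=> we wd j; rewrite (_ : (fun q => _) = eeval (e j)).
  exact: (eeval_diff (wd j)).1.
by apply/funext => q; exact: we.
Qed.

Let dZ (w : 'rV[R]_5 -> 'rV[R]_5) c p :
  (forall j, differentiable (fun q => w q 0 j) p) ->
  (forall j, differentiable (fun q => (c *: w q) 0 j) p).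
Proof.
move=> dw j; rewrite (_ : (fun q => _) = fun q => c * w q 0 j).
  by apply: differentiableM => //; exact: differentiable_cst.
by apply/funext => q; rewrite mxE.
Qed.

(** Among Omega_1, ..., Omega_4 only a rotation survives, in keeping with the complex-linear ansatz.
    Matching E, F in d theta_1 gives k alpha = lam v, and matching dx, F in d theta_3 gives v^2 =
    lam (1 - alpha^2), whence the opposite signs of lam in the two cases. *)
Lemma cofr_cartan U : cartan_equations U cofr1 cofr2 cofr3 cofr4 cofr5
  (fun=> 0) conn2 (fun p => - conn2 p) (fun=> 0) (fun p => - (3 / 4) *: cofr4 p)
  (fun p => - (3 / 4) *: cofr5 p) (fun p => (3 / 4) *: cofr3 p).
Proof.
move=> p Up.
have dA : forall j, differentiable (fun q => pfaffA alpha q 0 j) p.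
  exact: dexpr expr_pfaffAE _.
have dB : forall j, differentiable (fun q => pfaffB alpha q 0 j) p.
  exact: dexpr expr_pfaffBE _.
have dE : forall j, differentiable (fun q => pfaffE q 0 j) p.
  exact: dexpr expr_pfaffEE _.
have dF : forall j, differentiable (fun q => pfaffF q 0 j) p.
  exact: dexpr expr_pfaffFE _.
have dX : forall j, differentiable (fun q : 'rV[R]_5 => (dx : 'rV[R]_5) 0 j) p.
  by move=> j; exact: differentiable_cst.
have e1 := ext_derivZ k dA; have e2 := ext_derivZ k dB.
have e3 := ext_derivZ lam dE.
have e4 := ext_derivD (dZ (- u) dB) (dZ v dF).
have e5 := ext_derivD (dZ u dA) (dZ v dX).
rewrite (ext_derivZ _ dB) (ext_derivZ _ dF) in e4.
rewrite (ext_derivZ _ dA) (ext_derivZ _ dX) ext_deriv_dx in e5.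
rewrite ext_deriv_pfaffA in e1 e5; rewrite ext_deriv_pfaffB in e2 e4.
rewrite ext_deriv_pfaffE in e3; rewrite ext_deriv_pfaffF in e4.
rewrite [ext_deriv _ _]e1 [ext_deriv _ _]e2 [ext_deriv _ _]e3.
rewrite [ext_deriv _ _]e4 [ext_deriv _ _]e5.
rewrite /cofr1 /cofr2 /cofr4 /cofr5 /conn2 /cofr3 /pfaffF /pfaffC.
clear dA dB dE dF dX e1 e2 e3 e4 e5.
(* The forms become arbitrary rows and sin x, cos x arbitrary scalars: only bilinear algebra and the
   relations among the constants remain. *)
move: (pfaffA alpha p) (pfaffB alpha p) (pfaffE p) => A B E.
move: dx dq (sin (cx p)) (cos (cx p)) => X D s c.
split; apply/matrixP => i j; rewrite /wedge !mxE !big_ord1 !mxE /mu;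
 move: (A ord0 i) (A ord0 j) (B ord0 i) (B ord0 j) (E ord0 i) (E ord0 j)
   (X ord0 i) (X ord0 j) (D ord0 i) (D ord0 j) =>
   a1 a2 b1 b2 e1 e2 x1 x2 d1 d2.
all: by case: params => -[-> -> -> -> ->]; field: eps2.
Qed.

End Coframe.

(** * Pairings and dual frames *)

Section Pairing.
Context {K : fieldType} {n : nat}.
Implicit Types (a b w x y : 'rV[K]_n) (c : K).

Definition pair w x : K := \sum_i w 0 i * x 0 i.

Lemma pairDl w w' x : pair (w + w') x = pair w x + pair w' x.
Proof. by rewrite -big_split; apply: eq_bigr => i _; rewrite mxE mulrDl. Qed.

Lemma pairZl c w x : pair (c *: w) x = c * pair w x.
Proof. by rewrite mulr_sumr; apply: eq_bigr => i _; rewrite mxE mulrA. Qed.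

Lemma pairC w x : pair w x = pair x w.
Proof. by apply: eq_bigr => i _; rewrite mulrC. Qed.

Lemma pairDr w x y : pair w (x + y) = pair w x + pair w y.
Proof. by rewrite pairC pairDl !(pairC w). Qed.

Lemma pairZr c w x : pair w (c *: x) = c * pair w x.
Proof. by rewrite pairC pairZl pairC. Qed.

Lemma pair0l x : pair 0 x = 0.
Proof. by rewrite /pair big1// => i _; rewrite mxE mul0r. Qed.

Lemma pairNl w x : pair (- w) x = - pair w x.
Proof. by rewrite -scaleN1r pairZl mulN1r. Qed.

Lemma pairNr w x : pair w (- x) = - pair w x.
Proof. by rewrite pairC pairNl pairC. Qed.

Lemma pair_suml (I : Type) (r : seq I) (F : I -> 'rV[K]_n) x :
  pair (\sum_(i <- r) F i) x = \sum_(i <- r) pair (F i) x.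
Proof. exact: (big_morph (pair^~ x) (fun a b => pairDl a b x) (pair0l x)). Qed.

Lemma mulmx_pair w x : w *m x^T = (pair w x)%:M.
Proof.
apply/matrixP => i j; rewrite !ord1 !mxE eqxx mulr1n.
by apply: eq_bigr => k _; rewrite mxE.
Qed.

Lemma mulmx_pair0 w x : w *m x^T = 0 <-> pair w x = 0.
Proof.
rewrite mulmx_pair; split=> [/matrixP/(_ 0 0)|->]; last exact: raddf0.
by rewrite !mxE eqxx mulr1n.
Qed.

Lemma dual_free m (w x : 'I_m -> 'rV[K]_n) :
  (forall i j, pair (w i) (x j) = (i == j)%:R) -> free [tuple w i | i < m].
Proof.
move=> wx; apply/freeP => k k0 i.
have : pair (\sum_i k i *: [tuple w i | i < m]`_i) (x i) = 0.
  by rewrite k0 pair0l.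
rewrite pair_suml (bigD1 i)//= big1 ?addr0 => [|j ji].
  by rewrite nth_mktuple pairZl wx eqxx mulr1.
by rewrite nth_mktuple pairZl wx (negbTE ji) mulr0.
Qed.

End Pairing.

Section DualFrame.
Context {R : realType}.
Variables alpha k lam u v : R.
Implicit Types (p : 'rV[R]_5) (i j : 'I_5).

Definition row5 (a b c d e : R) : 'rV[R]_5 := \row_j [:: a; b; c; d; e]`_j.

(** The frame dual to A, B, E, dx, sin x dq. Its denominators sin theta and sin x are the two
    functions that [M5] keeps away from zero. *)
Definition frA p : 'rV[R]_5 :=
  row5 (- (cos (ctheta p) * sin (cz p) / sin (ctheta p)))
    (cos (cz p)) (sin (cz p) / sin (ctheta p)) 0 0.
Definition frB p : 'rV[R]_5 :=
  row5 (cos (ctheta p) * cos (cz p) / sin (ctheta p))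
    (sin (cz p)) (- (cos (cz p) / sin (ctheta p))) 0 0.
Definition frE p : 'rV[R]_5 := row5 (-1) 0 0 0 0.
Definition frX p : 'rV[R]_5 :=
  row5 (alpha * (cos (ctheta p) * sin (cz p) / sin (ctheta p)))
    (- (alpha * cos (cz p))) (- (alpha * (sin (cz p) / sin (ctheta p)))) 1 0.
Definition frF p : 'rV[R]_5 :=
  row5 (alpha * (cos (ctheta p) * cos (cz p) / sin (ctheta p))
        + cos (cx p) / sin (cx p))
    (alpha * sin (cz p)) (- (alpha * (cos (cz p) / sin (ctheta p)))) 0
    (sin (cx p))^-1.

Lemma pair5 (a b : 'rV[R]_5) : pair a b = a 0 i_z * b 0 i_z
  + a 0 i_theta * b 0 i_theta + a 0 i_phi * b 0 i_phi + a 0 i_x * b 0 i_x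
  + a 0 i_q * b 0 i_q.
Proof. by rewrite /pair sum_ord5. Qed.

Definition bcofr p i : 'rV[R]_5 :=
  [:: pfaffA alpha p; pfaffB alpha p; pfaffE p; dx; pfaffF p]`_i.
Definition bfr p i : 'rV[R]_5 := [:: frA p; frB p; frE p; frX p; frF p]`_i.

Lemma bcofr_bfr p i j : M5 p -> pair (bcofr p i) (bfr p j) = (i == j)%:R.
Proof.
move=> [st sx].
have hz : cos (cz p) ^+ 2 = 1 - sin (cz p) ^+ 2.
  by rewrite -(cos2Dsin2 (cz p)) addrK.
rewrite pair5 /bcofr /bfr.
elim/ord5P: i; elim/ord5P: j; rewrite /= ?pfaffAE ?pfaffBE ?pfaffEE !mxE /=.
all: by field: hz; rewrite ?st ?sx.
Qed.

Definition elem_row (U : set 'rV[R]_5) (w : 'rV[R]_5 -> 'rV[R]_5) : Prop :=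
  forall j, elem U (fun p => w p 0 j).

Lemma elem_rowD U w w' : elem_row U w -> elem_row U w' ->
  elem_row U (fun p => w p + w' p).
Proof.
by move=> ew ew' j; apply: elem_eq (elemD (ew j) (ew' j)) => p _; rewrite mxE.
Qed.

Lemma elem_rowZ U f w : elem U f -> elem_row U w ->
  elem_row U (fun p => f p *: w p).
Proof.
by move=> ef ew j; apply: elem_eq (elemM ef (ew j)) => p _; rewrite mxE.
Qed.

Lemma elem_row_cst U (w : 'rV[R]_5) : elem_row U (fun=> w).
Proof. by move=> j; exact: elem_cst. Qed.

Lemma elem_row5 U a b c d e : elem U a -> elem U b -> elem U c -> elem U d ->
  elem U e -> elem_row U (fun p => row5 (a p) (b p) (c p) (d p) (e p)).
Proof.
move=> ea eb ec ed ee; rewrite /elem_row.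
by elim/ord5P;
  [move: ea|move: eb|move: ec|move: ed|move: ee]; apply: elem_eq => p _; rewrite mxE.
Qed.

Lemma elem_row_smooth U w : open U -> elem_row U w -> smooth_mx_on U w.
Proof. by move=> oU ew i j; rewrite ord1; exact: (elem_smooth oU). Qed.

Let esth : elem M5 (fun p => sin (ctheta p)).
Proof. by apply: elem_sin; exact: elem_coord. Qed.
Let ecth : elem M5 (fun p => cos (ctheta p)).
Proof. by apply: elem_cos; exact: elem_coord. Qed.
Let esz : elem M5 (fun p => sin (cz p)).
Proof. by apply: elem_sin; exact: elem_coord. Qed.
Let ecz : elem M5 (fun p => cos (cz p)).
Proof. by apply: elem_cos; exact: elem_coord. Qed.
Let esx : elem M5 (fun p => sin (cx p)).
Proof. by apply: elem_sin; exact: elem_coord. Qed.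
Let ecx : elem M5 (fun p => cos (cx p)).
Proof. by apply: elem_cos; exact: elem_coord. Qed.
Let eisth : elem M5 (fun p => (sin (ctheta p))^-1).
Proof. by apply: elemV => // p []. Qed.
Let eisx : elem M5 (fun p => (sin (cx p))^-1).
Proof. by apply: elemV => // p []. Qed.

Lemma elem_bcofr i : elem_row M5 (fun p => bcofr p i).
Proof.
move=> j; elim/ord5P: i.
- by exists (expr_pfaffA alpha j) => p _; rewrite -expr_pfaffAE.
- by exists (expr_pfaffB alpha j) => p _; rewrite -expr_pfaffBE.
- by exists (expr_pfaffE j) => p _; rewrite -expr_pfaffEE.
- exact: elem_cst.
- by exists (expr_pfaffF j) => p _; rewrite -expr_pfaffFE.
Qed.

Lemma elem_bfr i : elem_row M5 (fun p => bfr p i).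
Proof.
elim/ord5P: i; apply: elem_row5; rewrite /cst.
all: do ?[assumption | exact: elem_cst | apply: elemN | apply: elemM | apply: elemD].
Qed.

Definition cofr p i : 'rV[R]_5 :=
  [:: cofr1 alpha k p; cofr2 alpha k p; cofr3 lam p; cofr4 alpha u v p;
      cofr5 alpha u v p]`_i.

(** The inverse transpose of the constant matrix that passes from the basic forms to [cofr], applied
    to the basic frame. *)
Definition fr p i : 'rV[R]_5 :=
  [:: k^-1 *: (frA p - (u / v) *: frX p); k^-1 *: (frB p + (u / v) *: frF p);
      lam^-1 *: frE p; v^-1 *: frF p; v^-1 *: frX p]`_i.

Hypotheses (k0 : k != 0) (lam0 : lam != 0) (v0 : v != 0).

Lemma cofr_fr p i j : M5 p -> pair (cofr p i) (fr p j) = (i == j)%:R.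
Proof.
move=> Mp; have b i' j' := bcofr_bfr i' j' Mp.
have := b i_z; have := b i_theta; have := b i_phi; have := b i_x.
have := b i_q; rewrite {b}/bcofr /bfr /= => bF bX bE bB bA.
have := (bA i_z, bA i_theta, bA i_phi, bA i_x, bA i_q).
have := (bB i_z, bB i_theta, bB i_phi, bB i_x, bB i_q).
have := (bE i_z, bE i_theta, bE i_phi, bE i_x, bE i_q).
have := (bX i_z, bX i_theta, bX i_phi, bX i_x, bX i_q).
have := (bF i_z, bF i_theta, bF i_phi, bF i_x, bF i_q).
rewrite /= => {}bF {}bX {}bE {}bB {}bA.
rewrite /cofr /fr /cofr1 /cofr2 /cofr3 /cofr4 /cofr5.
move: bA bB bE bX bF.
move: (pfaffA alpha p) (pfaffB alpha p) (pfaffE p) (pfaffF p) dx (frA p) (frB p).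
move: (frE p) (frX p) (frF p) => e x f A B E F X a b bA bB bE bX bF.
elim/ord5P: i; elim/ord5P: j => /=;
  rewrite !(pairDl, pairZl, pairDr, pairZr, pairNr) ?bA ?bB ?bE ?bX ?bF.
all: by field; rewrite ?k0 ?lam0 ?v0.
Qed.

Lemma elem_cofr i : elem_row M5 (fun p => cofr p i).
Proof.
have eA := elem_bcofr i_z; have eB := elem_bcofr i_theta.
have eE := elem_bcofr i_phi; have eX := elem_bcofr i_x.
have eF := elem_bcofr i_q.
have ec c : elem M5 (fun=> c) := elem_cst _ _.
elim/ord5P: i; do ?apply: elem_rowD; exact: elem_rowZ.
Qed.

Lemma elem_fr i : elem_row M5 (fun p => fr p i).
Proof.
have eA := elem_bfr i_z; have eB := elem_bfr i_theta.
have eE := elem_bfr i_phi; have eX := elem_bfr i_x.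
have eF := elem_bfr i_q.
have ec c : elem M5 (fun=> c) := elem_cst _ _.
elim/ord5P: i; apply: elem_rowZ => //.
  rewrite /= ; under eq_fun do rewrite -scaleNr.
  by apply: elem_rowD => //; exact: elem_rowZ.
by apply: elem_rowD => //; exact: elem_rowZ.
Qed.

Lemma cofr_free p : M5 p -> free
  [:: cofr1 alpha k p; cofr2 alpha k p; cofr3 lam p; cofr4 alpha u v p;
      cofr5 alpha u v p].
Proof.
move=> Mp; have := dual_free (fun i j => cofr_fr i j Mp).
congr (is_true (free _)); apply: (@eq_from_nth _ 0) => [|i].
  by rewrite size_tuple.
rewrite size_tuple => i5.
have -> : i = Ordinal i5 by [].
by rewrite nth_mktuple.
Qed.

Lemma cofr_mx_unit p : M5 p -> \matrix_i cofr p i \in unitmx.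
Proof.
move=> Mp; have : (\matrix_i cofr p i) *m (\matrix_i fr p i)^T = 1%:M.
  apply/matrixP => i j; rewrite !mxE -(cofr_fr i j Mp).
  by apply: eq_bigr => l _; rewrite !mxE.
by case/mulmx1_unit.
Qed.

End DualFrame.

(** * Membership in Nurowski's conformal class *)

Section Nurowski.
Context {R : realType}.
Implicit Types (p : 'rV[R]_5) (i j : 'I_5).

(** Gram matrix of Nurowski's metric in its coframe; with indices counted from 0, the antidiagonal
    is i + j = 4. *)
Definition nurowski_mx : 'M[R]_5 :=
  \matrix_(i, j) if (i + j == 4)%N then [:: 1; -1; 4 / 3; -1; 1]`_i else 0.

Lemma nurowski_mx_unit : nurowski_mx \in unitmx.
Proof.
pose C' : 'M[R]_5 :=
  \matrix_(i, j) if (i + j == 4)%N then [:: 1; -1; 3 / 4; -1; 1]`_i else 0.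
have : nurowski_mx *m C' = 1%:M.
  apply/matrixP => i j; rewrite !mxE !big_ord_recr big_ord0 /= !mxE.
  by elim/ord5P: i; elim/ord5P: j => /=; field.
by case/mulmx1_unit.
Qed.

Lemma nurowski_metricE (t1 t2 t3 t4 t5 : 'rV[R]_5 -> 'rV[R]_5) p :
  let T := \matrix_(i < 5) [:: t1 p; t2 p; t3 p; t4 p; t5 p]`_i in
  nurowski_metric t1 t2 t3 t4 t5 p = T^T *m nurowski_mx *m T.
Proof.
apply/matrixP => i j; rewrite /nurowski_metric /symprod !mxE !big_ord1 !mxE.
rewrite !big_ord_recr !big_ord0 /= !mxE !big_ord_recr !big_ord0 /= !mxE /=.
move: (t1 p _ i) (t2 p _ i) (t3 p _ i) (t4 p _ i) (t5 p _ i).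
move: (t1 p _ j) (t2 p _ j) (t3 p _ j) (t4 p _ j) (t5 p _ j).
by move=> *; field.
Qed.

Lemma M5_open : open (@M5 R).
Proof.
have cs (l : 'I_5) : continuous (fun p : 'rV[R]_5 => sin (p 0 l)).
  move=> p; apply: (@continuous_comp _ _ _ (fun q : 'rV[R]_5 => q 0 l) sin).
    exact: coord_continuous.
  exact: continuous_sin.
have o (l : 'I_5) : open [set p : 'rV[R]_5 | sin (p 0 l) != 0].
  exact: (open_comp (fun p _ => cs l p) (@open_neq R 0)).
exact: (openI (o i_theta) (o i_x)).
Qed.

Lemma toC_mul m n q (A : 'M[R]_(m, n)) (B : 'M[R]_(n, q)) :
  toC A *m toC B = toC (A *m B).
Proof. by rewrite /toC map_mxM. Qed.

Lemma complex_eq0 (x y : R) : x%:C%C + 'i%C * y%:C%C = 0 <-> x = 0 /\ y = 0.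
Proof.
split=> [/eqP|[-> ->]]; last by rewrite rmorph0 mulr0 addr0.
rewrite eq_complex /= !(mul0r, mul1r, mulr0, subr0, addr0, add0r, oppr0).
by move=> /andP[/eqP-> /eqP->].
Qed.

Lemma complex_mx_eq0 m n (A B : 'M[R]_(m, n)) :
  toC A + 'i%C *: toC B = 0 <-> A = 0 /\ B = 0.
Proof.
split=> [AB|[-> ->]]; last by rewrite /toC !map_mx0 scaler0 addr0.
have H a b : A a b = 0 /\ B a b = 0.
  by apply/complex_eq0; have /matrixP/(_ a b) := AB; rewrite !mxE.
by split; apply/matrixP => a b; rewrite mxE; have [] := H a b.
Qed.

(** On a real vector [eta1] vanishes exactly when its real and imaginary parts do, and the conjugate
    form [eta2] gives the same two conditions. *)
Lemma pfaff_kernelE (alpha : R) p (w : 'rV[R]_5) :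
  pfaff_kernel alpha p w <->
  [/\ pair (pfaffA alpha p) w = 0, pair (pfaffB alpha p) w = 0
    & pair (pfaffE p) w = 0].
Proof.
have eta1w : eta1 alpha p *m (toC w)^T = 0 <->
    pfaffA alpha p *m w^T = 0 /\ pfaffB alpha p *m w^T = 0.
  rewrite eta1_real mulmxDl -scalemxAl /toC map_trmx !toC_mul.
  exact: complex_mx_eq0.
have eta2w : eta2 alpha p *m (toC w)^T = 0 <->
    pfaffA alpha p *m w^T = 0 /\ pfaffB alpha p *m w^T = 0.
  rewrite eta2_real mulmxBl -scalemxAl /toC map_trmx !toC_mul -scalerN -toCN.
  by rewrite complex_mx_eq0; split=> -[-> /eqP];
    rewrite ?oppr_eq0 => /eqP->; rewrite ?oppr0.
have eta3w : eta3 p *m (toC w)^T = 0 <-> pfaffE p *m w^T = 0.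
  rewrite eta3_real /toC map_trmx toC_mul.
  by split=> /eqP; [rewrite map_mx_eq0|rewrite -(map_mx_eq0 (real_complex R))] => /eqP.
split=> [[/eta1w[/mulmx_pair0 ? /mulmx_pair0 ?] _ /eta3w/mulmx_pair0 ?]//|].
move=> [/mulmx_pair0 Aw /mulmx_pair0 Bw /mulmx_pair0 Ew].
by split; [apply/eta1w|apply/eta2w|apply/eta3w].
Qed.

Section Class.
Variables (b : bool) (eps : R).
Hypothesis eps2 : eps ^+ 2 = 1.

Definition par_alpha := if b then eps / 3 else eps * 3.
Definition par_k : R := if b then 1 else 3^-1.
Definition par_lam : R := if b then 2^-1 else - 2^-1.
Definition par_u : R := if b then - 2^-1 else 2^-1.
Definition par_v := if b then 2 / 3 * eps else - (2 * eps).

Local Notation t1 := (cofr1 par_alpha par_k).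
Local Notation t2 := (cofr2 par_alpha par_k).
Local Notation t3 := (cofr3 par_lam).
Local Notation t4 := (cofr4 par_alpha par_u par_v).
Local Notation t5 := (cofr5 par_alpha par_u par_v).

Let eps0 : eps != 0.
Proof. by apply: contra_eq_neq eps2 => ->; rewrite expr0n eq_sym oner_eq0. Qed.

Lemma par_k0 : par_k != 0.
Proof. by rewrite /par_k; case: b; rewrite ?oner_eq0 ?invr_eq0 ?pnatr_eq0. Qed.

Lemma par_lam0 : par_lam != 0.
Proof. by rewrite /par_lam; case: b; rewrite ?oppr_eq0 invr_eq0 pnatr_eq0. Qed.

Lemma par_v0 : par_v != 0.
Proof.
rewrite /par_v; case: b; rewrite ?oppr_eq0 !mulf_neq0// ?invr_eq0 pnatr_eq0//.
Qed.

Lemma parP :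
  [/\ par_alpha = eps / 3, par_k = 1, par_lam = 2^-1, par_u = - 2^-1
    & par_v = 2 / 3 * eps] \/
  [/\ par_alpha = eps * 3, par_k = 3^-1, par_lam = - 2^-1, par_u = 2^-1
    & par_v = - (2 * eps)].
Proof.
by rewrite /par_alpha /par_k /par_lam /par_u /par_v; case: b; [left|right].
Qed.

(** The factor 9 is fixed by the square of E: lam^2 = 1/4 in both cases, and 9 (4/3) (1/4) = 3. *)
Lemma cone_metric_nurowski p :
  cone_metric b eps p = 9 *: nurowski_metric t1 t2 t3 t4 t5 p.
Proof.
apply/matrixP => i j; rewrite /cone_metric /nurowski_metric /symprod.
have hz : cos (cz p) ^+ 2 = 1 - sin (cz p) ^+ 2.
  by rewrite -(cos2Dsin2 (cz p)) addrK.
rewrite /par_alpha /par_k /par_lam /par_u /par_v.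
case: b; rewrite !mxE !big_ord1 !mxE /=;
move: (cos (cz p)) (sin (cz p)) (cos (ctheta p)) (sin (ctheta p)) hz;
move: (cos (cx p)) (sin (cx p)) => cx sx c s ct st hz;
move: (i == i_z)%:R (j == i_z)%:R (i == i_theta)%:R (j == i_theta)%:R;
move: (i == i_phi)%:R (j == i_phi)%:R (i == i_x)%:R (j == i_x)%:R;
move: (i == i_q)%:R (j == i_q)%:R;
move=> y1 y2 y3 y4 y5 y6 y7 y8 y9 y10; by field: eps2 hz.
Qed.

(** Nondegeneracy comes from the coframe: the metric is congruent to a multiple of a constant
    invertible matrix, and no trigonometric determinant is computed. *)
Lemma cone_metric_unit p : M5 p -> cone_metric b eps p \in unitmx.
Proof.
move=> Mp; rewrite cone_metric_nurowski nurowski_metricE.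
rewrite unitmxZ; last by rewrite unitfE pnatr_eq0.
have := cofr_mx_unit par_alpha par_u par_k0 par_lam0 par_v0 Mp.
rewrite /cofr; set T := \matrix_i _ => uT.
by rewrite !unitmx_mul unitmx_tr uT nurowski_mx_unit.
Qed.

Lemma par_kernel p : pfaff_kernel par_alpha p =
  [set w | [/\ pair (t1 p) w = 0, pair (t2 p) w = 0 & pair (t3 p) w = 0]].
Proof.
have Z c (a w : 'rV[R]_5) : c != 0 -> pair (c *: a) w = 0 <-> pair a w = 0.
  move=> c0; rewrite pairZl; split=> [/eqP|->]; last by rewrite mulr0.
  by rewrite mulf_eq0 (negbTE c0)/= => /eqP.
apply/seteqP; split=> w.
  by move=> /pfaff_kernelE[? ? ?]; split; apply/Z => //; rewrite ?par_k0 ?par_lam0.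
move=> [/(Z _ _ _ par_k0) ? /(Z _ _ _ par_k0) ? /(Z _ _ _ par_lam0) ?].
exact/pfaff_kernelE.
Qed.

Lemma par_cartan_coframe : cartan_coframe M5 (pfaff_kernel par_alpha) t1 t2 t3 t4 t5.
Proof.
have sm i : smooth_mx_on M5 (fun p => cofr par_alpha par_k par_lam par_u par_v p i).
  exact: (elem_row_smooth M5_open (elem_cofr _ _ _ _ _ i)).
have s0 : smooth_mx_on M5 (fun=> 0 : 'rV[R]_5).
  exact: (elem_row_smooth M5_open (elem_row_cst _ _)).
have ec i := elem_cofr par_alpha par_k par_lam par_u par_v i.
have eC : elem_row M5 (@pfaffC R).
  apply: elem_rowZ; last exact: elem_row_cst.
  by apply: elem_cos; exact: elem_coord.
have e2 : elem_row M5 (conn2 par_k par_lam par_u).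
  apply: elem_rowD => //; apply: elem_rowZ; first exact: elem_cst.
  exact: (ec i_phi).
have sZ c i : smooth_mx_on M5 (fun p =>
    c *: cofr par_alpha par_k par_lam par_u par_v p i).
  by apply: (elem_row_smooth M5_open); apply: elem_rowZ => //; exact: elem_cst.
split.
- split; [exact: (sm i_z)|exact: (sm i_theta)|exact: (sm i_phi)|exact: (sm i_x)
         |exact: (sm i_q)].
- by move=> p Mp; exact: (cofr_free _ _ par_k0 par_lam0 par_v0 Mp).
- move=> p _; rewrite par_kernel; apply/seteqP; split=> w [? ? ?];
    by split; apply/mulmx_pair0.
exists (fun=> 0), (conn2 par_k par_lam par_u), (fun p => - conn2 par_k par_lam par_u p),
  (fun=> 0), (fun p => - (3 / 4) *: t4 p), (fun p => - (3 / 4) *: t5 p),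
  (fun p => (3 / 4) *: t3 p).
split.
- split=> //; first exact: (elem_row_smooth M5_open).
  apply: (elem_row_smooth M5_open) => j.
  by apply: elem_eq (elemN (e2 j)) => p _; rewrite [RHS]mxE.
- by split; [exact: (sZ _ i_x)|exact: (sZ _ i_q)|exact: (sZ _ i_phi)].
- exact: (cofr_cartan eps2 parP).
Qed.

Lemma cone_in_nurowski_class :
  in_nurowski_class M5 (pfaff_kernel par_alpha) (cone_metric b eps).
Proof.
move=> p Mp; exists M5; split; first by split=> //; exact: M5_open.
exists t1, t2, t3, t4, t5, (fun=> 9); split.
- exact: par_cartan_coframe.
- exact: (elem_smooth M5_open (elem_cst _ _)).
- by move=> q _; rewrite pnatr_eq0.
- by move=> q _; exact: cone_metric_nurowski.
Qed.

End Class.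
End Nurowski.

(** * Curvature of the two metrics *)

Section ConeMetric.
Context {R : realType}.
Variables (b : bool) (eps : R).
Hypothesis eps2 : eps ^+ 2 = 1.
Implicit Types (p : 'rV[R]_5) (i j : 'I_5).

Let t := if b then i_theta else i_x.
Let f := if b then i_phi else i_q.

Definition coneX : seq (expr R 5) := conen t f ++ coneY eps.

Definition Xfun (k : 'I_(2 + 5)) p : R := eeval (nth (ECst 0) coneX k) p.

Definition coneh (k : 'I_(2 + 5)) : R := if (k < 3)%N then - 12 else 12.

(** The null vector (-n, Y) / 24: its product with (n, Y) is (12 + 12) / 24 = 1. *)
Definition Nfun (k : 'I_(2 + 5)) p : R :=
  (if (k < 3)%N then - 24^-1 else 24^-1) * Xfun k p.

Lemma cone_sum (c : bool -> R) (F : expr R 5 -> R) :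
  \sum_(k < 2 + 5) c (k < 3)%N * F (nth (ECst 0) coneX k) =
  c true * (\sum_(e <- conen t f) F e) + c false * (\sum_(e <- coneY eps) F e).
Proof.
rewrite !big_ord_recl big_ord0 !big_cons !big_nil /=; ring.
Qed.

Lemma coneX_wd k p : ewd (nth (ECst 0) coneX k) p.
Proof.
(* Past the seven components, [nth] returns a constant expression. *)
by do 7 (case: k => [|k]; first by do ?split); rewrite nth_default.
Qed.

Lemma coneY_norm p : \sum_(e <- coneY eps) eeval e p * eeval e p = 1.
Proof.
rewrite !big_cons big_nil /=.
set a := 2^-1 * (p 0 i_phi + -1 * p 0 i_q).
set c := 2^-1 * (p 0 i_phi + 1 * p 0 i_q).
set u := 2^-1 * (p 0 i_theta + eps * p 0 i_x).
set v := 2^-1 * (p 0 i_theta + - eps * p 0 i_x).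
set k := 2^-1 * p 0 i_z.
have h (x : R) : cos x ^+ 2 = 1 - sin x ^+ 2 by rewrite -(cos2Dsin2 x) addrK.
move: (h a) (h c) (h u) (h v) (h k).
move: (cos a) (sin a) (cos c) (sin c) (cos u) (sin u) (cos v) (sin v)
  (cos k) (sin k) => ca sa cc sc cu su cv sv ck sk ha hc hu hv hk.
by ring: ha hc hu hv hk.
Qed.

Lemma conen_norm p : \sum_(e <- conen t f) eeval e p * eeval e p = 1.
Proof.
rewrite !big_cons big_nil /=.
have h (x : R) : cos x ^+ 2 = 1 - sin x ^+ 2 by rewrite -(cos2Dsin2 x) addrK.
move: (h (p 0 t)) (h (p 0 f)) => h1 h2.
by ring: h1 h2.
Qed.

Lemma conen_gram p i j :
  \sum_(e <- conen t f) eeval (ederiv i e) p * eeval (ederiv j e) p =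
  sphere_metric (p 0 t) (delta_mx 0 t) (delta_mx 0 f) i j.
Proof.
rewrite !big_cons big_nil !mxE !big_ord1 !mxE /=.
have h (x : R) : cos x ^+ 2 = 1 - sin x ^+ 2 by rewrite -(cos2Dsin2 x) addrK.
move: (h (p 0 t)) (h (p 0 f)) => h1 h2.
by ring: h1 h2.
Qed.

Lemma partial_Xfun i k p : partial i (Xfun k) p =
  eeval (ederiv i (nth (ECst 0) coneX k)) p.
Proof. by have [_ <-] := eeval_diff (coneX_wd k p). Qed.

Lemma elem_Xfun U k : elem U (Xfun k).
Proof. by exists (nth (ECst 0) coneX k) => p _; split=> //; exact: coneX_wd. Qed.

Lemma cone_XX p : ip coneh (Xfun^~ p) (Xfun^~ p) = 0.
Proof.
have := cone_sum (fun c => if c then - 12 else 12) (fun e => eeval e p * eeval e p).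
rewrite coneY_norm conen_norm => e.
rewrite -[RHS](_ : - 12 * 1 + 12 * 1 = 0); last by ring.
by rewrite -e; apply: eq_bigr => k _; rewrite mulrA.
Qed.

(** The weight 12 on R^4 meets the factor 1/4 of [coneY_gram], which accounts for the coefficient
    3. *)
Lemma cone_DD p i j : ip coneh (fun k => partial i (Xfun k) p)
  (fun k => partial j (Xfun k) p) = cone_metric b eps p i j.
Proof.
have := cone_sum (fun c => if c then - 12 else 12)
  (fun e => eeval (ederiv i e) p * eeval (ederiv j e) p).
rewrite conen_gram coneY_gram// => e.
transitivity (\sum_(k < 2 + 5) (if (k < 3)%N then - 12 else 12) *
  (eeval (ederiv i (nth (ECst 0) coneX k)) p *
   eeval (ederiv j (nth (ECst 0) coneX k)) p)).
  by apply: eq_bigr => k _; rewrite !partial_Xfun mulrA.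
rewrite {}e /cone_metric -!sqformE (_ : (if b then sphere_metric _ _ _ else _) =
  sphere_metric (p 0 t) (delta_mx 0 t) (delta_mx 0 f)); last first.
  by rewrite /t /f; case: b.
move: (sqform _) (sqform _) (sqform _) (sphere_metric _ _ _) => A B E S.
by rewrite !mxE; field.
Qed.

(** The signs in N undo those of [coneh], so pairing with N is half the Euclidean product with X.
    Since X has constant Euclidean norm, N is orthogonal to its derivatives. *)
Lemma ip_Nfun p a : ip coneh (Nfun^~ p) a = 2^-1 * ip (fun=> 1) (Xfun^~ p) a.
Proof.
rewrite mulr_sumr; apply: eq_bigr => k _; rewrite /coneh /Nfun.
by case: ifP => _; field.
Qed.

Lemma cone_X1X p : ip (fun=> 1) (Xfun^~ p) (Xfun^~ p) = 2.
Proof.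
have := cone_sum (fun=> 1) (fun e => eeval e p * eeval e p).
rewrite coneY_norm conen_norm => e.
rewrite -[RHS](_ : 1 * 1 + 1 * 1 = 2); last by ring.
by rewrite -e; apply: eq_bigr => k _; rewrite mulrA.
Qed.

Lemma cone_XN p : ip coneh (Xfun^~ p) (Nfun^~ p) = 1.
Proof. by rewrite ipC ip_Nfun cone_X1X mulVf// pnatr_eq0. Qed.

Lemma cone_NN p : ip coneh (Nfun^~ p) (Nfun^~ p) = 0.
Proof.
rewrite -[RHS](mulr0 (24^-1 ^+ 2)) -(cone_XX p) mulr_sumr.
by apply: eq_bigr => k _; rewrite /Nfun; case: ifP => _; ring.
Qed.

Lemma cone_ND p i : ip coneh (Nfun^~ p) (fun k => partial i (Xfun k) p) = 0.
Proof.
rewrite ip_Nfun; apply/eqP; rewrite mulf_eq0 invr_eq0 pnatr_eq0/=.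
have dX k : differentiable (Xfun k) p by exact: (eeval_diff (coneX_wd k p)).1.
have := partial_cst 2 p i.
rewrite -(partial_eq_on i openT I (fun q _ => cone_X1X q)) partial_ip//.
by rewrite (ipC _ _ (Xfun^~ p)) -mulr2n => /eqP; rewrite mulrn_eq0.
Qed.

Lemma cone_weyl_vanishes : weyl_vanishes M5 (cone_metric b eps).
Proof.
apply: (@cone_weyl _ _ coneh M5 Xfun _ M5_open (elem_Xfun M5) _ _ Nfun) => //.
- by move=> p; exact: cone_metric_unit.
- by move=> p _; exact: cone_XX.
- by move=> p _; exact: cone_XN.
- by move=> p _; exact: cone_NN.
- by move=> p i _; exact: cone_ND.
- by move=> p i j _; exact: cone_DD.
Qed.

Lemma cone_conformally_flat : conformally_flat M5 (cone_metric b eps).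
Proof.
(* The null vector is N frozen at the given point: it gives u(p) = 1, so the rescaling is defined
   where u > 0, a neighbourhood of p. *)
move=> p Mp; pose v k := Nfun k p; pose u q := ip coneh v (Xfun^~ q).
have eu W : elem W u.
  by apply: (elem_ip coneh (A := fun k => fun=> v k)) => k;
    [exact: elem_cst|exact: elem_Xfun].
have up : u p = 1 by rewrite /u ipC cone_XN.
pose V := M5 `&` [set q | 0 < u q].
have oV : open V.
  apply: openI; first exact: M5_open.
  apply: (@open_comp _ _ u [set x | 0 < x]) => [q _|]; last exact: open_gt.
  exact/differentiable_continuous/(elem_differentiable openT (eu setT) I).
have u0 q : V q -> u q != 0 by move=> [_ /lt0r_neq0].
have sVM : V `<=` M5 by move=> q [].
exists V, (fun q => (u q)^-1 ^+ 2); split.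
- by split=> //; split=> //=; rewrite up ltr01.
- by apply: (elem_smooth oV); apply: elemX; exact: elemV.
- by move=> q [_ uq]; rewrite exprn_gt0// invr_gt0.
move=> q Vq l k i j.
apply: (@riemann_rescale_flat _ _ coneh V Xfun _ oV (elem_Xfun V) _ _ v) => //.
- move=> r Vr; rewrite unitmxZ; first exact: cone_metric_unit (sVM _ Vr).
  by rewrite unitfE expf_neq0// invr_eq0 u0.
- by move=> r _; exact: cone_XX.
- by move=> r a c Vr; rewrite cone_DD mxE.
- exact: cone_NN.
Qed.

Lemma cone_einstein p : M5 p -> cos (p 0 t) != 0 ->
  ricci (fun q => (4 / cos (q 0 t) ^+ 2) *: cone_metric b eps q) p =
  12^-1 *: ((4 / cos (p 0 t) ^+ 2) *: cone_metric b eps p).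
Proof.
(* The first component of X is cos t and has weight -12, so <v, X> = cos t / 2 and the conformal
   factor is 4 / cos^2 t. Also <v, v> = -12 / 24^2 = -1/48, and the Einstein constant is - (5 - 1)
   <v, v> = 1/12. *)
move=> Mp cp; pose v (k : 'I_(2 + 5)) : R := if k == ord0 then - 24^-1 else 0.
have ipv a : ip coneh v a = 2^-1 * a ord0.
  rewrite /ip big_ord_recl big1 ?addr0 => [|k _]; last by rewrite /v/= mulr0 mul0r.
  by rewrite /v /coneh /=; field.
pose V := M5 `&` [set q : 'rV[R]_5 | cos (q 0 t) != 0].
have oV : open V.
  apply: openI; first exact: M5_open.
  apply: (@open_comp _ _ (fun q : 'rV[R]_5 => cos (q 0 t)) [set x | x != 0]);
    last exact: open_neq.
  move=> q _; apply: (@continuous_comp _ _ _ (fun q : 'rV[R]_5 => q 0 t) cos).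
    exact: coord_continuous.
  exact: continuous_cos.
have uE q : ip coneh v (Xfun^~ q) = 2^-1 * cos (q 0 t) by rewrite ipv.
have u0 q : V q -> ip coneh v (Xfun^~ q) != 0.
  by move=> [_ cq]; rewrite uE mulf_neq0// invr_eq0 pnatr_eq0.
have fE q : V q -> 4 / cos (q 0 t) ^+ 2 = (ip coneh v (Xfun^~ q))^-1 ^+ 2.
  by move=> [_ cq]; rewrite uE; field; rewrite cq.
have Vp : V p by [].
rewrite (@ricci_rescale _ _ coneh V Xfun _ oV (elem_Xfun V) _ _ v)//.
- by congr (_ *: _); rewrite ipv /v /=; field.
- move=> r Vr; rewrite unitmxZ; first exact: cone_metric_unit Vr.1.
  by rewrite fE// unitfE expf_neq0// invr_eq0 u0.
- by move=> r _; exact: cone_XX.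
- by move=> r a c Vr; rewrite cone_DD mxE fE.
Qed.

End ConeMetric.

(** * Lie brackets and the (2,3,5) condition *)

Section DualBases.
Context {K : fieldType} {n : nat}.
Variables w e : 'I_n -> 'rV[K]_n.
Hypothesis we : forall i j, pair (w i) (e j) = (i == j)%:R.

Lemma dual_expand x : x = \sum_i pair (w i) x *: e i.
Proof.
pose W := \matrix_i w i; pose E := \matrix_i e i.
have EW : E^T *m W = 1%:M.
  apply: mulmx1C; apply/matrixP => i j; rewrite !mxE -we.
  by apply: eq_bigr => l _; rewrite !mxE.
have : E^T *m (W *m x^T) = x^T by rewrite mulmxA EW mul1mx.
move=> /(congr1 trmx); rewrite trmxK => {1}<-; apply/rowP => l.
rewrite mxE summxE !mxE; apply: eq_bigr => i _; rewrite !mxE mulrC.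
by congr (_ * _); apply: eq_bigr => j _; rewrite !mxE.
Qed.

(** Translates between generators and equations: a span of frame vectors is cut out by the
    complementary coframe forms. *)
Lemma dual_span m (s : 'I_m -> 'I_n) x :
  x \in <<[tuple e (s i) | i < m]>>%VS <->
  forall j, (forall i, s i != j) -> pair (w j) x = 0.
Proof.
split=> [xe j sj|x0].
  rewrite (coord_span xe) pairC pair_suml big1// => i _.
  by rewrite pairZl pairC nth_mktuple we eq_sym (negbTE (sj i)) mulr0.
rewrite (dual_expand x) memv_suml// => j _.
have [/existsP[i /eqP<-]|/existsPn sj] := boolP [exists i, s i == j].
  apply/memvZ/memv_span/tnthP; exists i.
  by rewrite tnth_mktuple.
by rewrite x0 ?scale0r ?mem0v// => i; exact: sj.
Qed.

End DualBases.

Section LieBracket.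
Context {R : realType} {n : nat}.
Implicit Types (w X Y : 'rV[R]_n -> 'rV[R]_n) (f : 'rV[R]_n -> R).
Implicit Types (p x y a b c d e g h : 'rV[R]_n).

Definition differentiable_row w p :=
  forall j, differentiable (fun q => w q 0 j) p.

Definition form2 (M : 'M[R]_n) x y := \sum_i \sum_j x 0 i * M i j * y 0 j.

Lemma form2D M M' x y : form2 (M + M') x y = form2 M x y + form2 M' x y.
Proof.
rewrite -big_split; apply: eq_bigr => i _; rewrite -big_split.
by apply: eq_bigr => j _; rewrite mxE /=; ring.
Qed.

Lemma form2_wedge a b x y :
  form2 (wedge a b) x y = pair a x * pair b y - pair b x * pair a y.
Proof.
rewrite /pair !mulr_suml -sumrB; apply: eq_bigr => i _.
rewrite !mulr_sumr -sumrB; apply: eq_bigr => j _.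
by rewrite !mxE !big_ord1 !mxE; ring.
Qed.

Lemma form2_wedge3 a b c d e (f : 'rV[R]_n) x y :
  form2 (wedge a b + wedge c d + wedge e f) x y =
  (pair a x * pair b y - pair b x * pair a y)
  + (pair c x * pair d y - pair d x * pair c y)
  + (pair e x * pair f y - pair f x * pair e y).
Proof.
by rewrite (form2D (wedge a b + wedge c d)) (form2D (wedge a b)) !form2_wedge.
Qed.

Lemma form2_wedge4 a b c d e (f : 'rV[R]_n) g h x y :
  form2 (wedge a b + wedge c d + wedge e f + wedge g h) x y =
  (pair a x * pair b y - pair b x * pair a y)
  + (pair c x * pair d y - pair d x * pair c y)
  + (pair e x * pair f y - pair f x * pair e y)
  + (pair g x * pair h y - pair h x * pair g y).
Proof.
by rewrite (form2D (wedge a b + wedge c d + wedge e f)) form2_wedge3 form2_wedge.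
Qed.

Lemma partial_pair w X p i : differentiable_row w p -> differentiable_row X p ->
  partial i (fun q => pair (w q) (X q)) p =
  \sum_j (partial i (fun q => w q 0 j) p * X p 0 j
          + w p 0 j * partial i (fun q => X q 0 j) p).
Proof.
move=> dw dX; rewrite partial_sum => [|j _]; last exact: differentiableM.
by apply: eq_bigr => j _; exact: partialM.
Qed.

(** By Leibniz, the terms that differentiate [w] assemble to its exterior derivative, those that
    differentiate X and Y to the bracket. *)
Lemma cartan_formula w X Y p : differentiable_row w p ->
  differentiable_row X p -> differentiable_row Y p ->
  pair (w p) (lie_bracket X Y p) =
  \sum_i X p 0 i * partial i (fun q => pair (w q) (Y q)) p
  - \sum_i Y p 0 i * partial i (fun q => pair (w q) (X q)) p
  - form2 (ext_deriv w p) (X p) (Y p).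
Proof.
move=> dw dX dY.
have E1 : form2 (ext_deriv w p) (X p) (Y p) =
    \sum_i \sum_j X p 0 i * partial i (fun q => w q 0 j) p * Y p 0 j
    - \sum_i \sum_j Y p 0 i * partial i (fun q => w q 0 j) p * X p 0 j.
  rewrite [X in _ - X]exchange_big -sumrB; apply: eq_bigr => i _.
  by rewrite -sumrB; apply: eq_bigr => j _; rewrite mxE; ring.
have E2 A B : differentiable_row A p -> differentiable_row B p ->
    \sum_i A p 0 i * partial i (fun q => pair (w q) (B q)) p =
    \sum_i \sum_j A p 0 i * partial i (fun q => w q 0 j) p * B p 0 j
    + \sum_j w p 0 j * \sum_i A p 0 i * partial i (fun q => B q 0 j) p.
  move=> dA dB; under [X in _ + X]eq_bigr do rewrite mulr_sumr.
  rewrite [X in _ + X]exchange_big -big_split; apply: eq_bigr => i _ /=.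
  rewrite partial_pair// mulr_sumr -big_split; apply: eq_bigr => j _ /=.
  by ring.
rewrite E1 (E2 X Y dX dY) (E2 Y X dY dX).
have -> : pair (w p) (lie_bracket X Y p) =
    \sum_j w p 0 j * (\sum_i X p 0 i * partial i (fun q => Y q 0 j) p)
    - \sum_j w p 0 j * (\sum_i Y p 0 i * partial i (fun q => X q 0 j) p).
  by rewrite -sumrB; apply: eq_bigr => j _; rewrite mxE -mulrBr -sumrB.
by ring.
Qed.

Lemma lie_bracketZr X Y f p : differentiable f p -> differentiable_row Y p ->
  lie_bracket X (fun q => f q *: Y q) p =
  f p *: lie_bracket X Y p + (\sum_i X p 0 i * partial i f p) *: Y p.
Proof.
move=> df dY; apply/rowP => k; rewrite !mxE mulr_sumr mulr_suml -big_split.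
apply: eq_bigr => i _ /=.
rewrite (_ : (fun q => _) = fun q => f q * Y q 0 k); last first.
  by apply/funext => q; rewrite mxE.
by rewrite partialM// mxE; ring.
Qed.

End LieBracket.

Section Distribution235.
Context {R : realType}.
Variables (U : set 'rV[R]_5) (D : 'rV[R]_5 -> set 'rV[R]_5).
Variables (w e : 'I_5 -> 'rV[R]_5 -> 'rV[R]_5).
Variables (o1 o2 o3 o4 o5 o6 o7 : 'rV[R]_5 -> 'rV[R]_5).
Hypotheses (oU : open U) (ew : forall i, elem_row U (w i)).
Hypothesis ee : forall i, elem_row U (e i).
Hypothesis we : forall p i j, U p -> pair (w i p) (e j p) = (i == j)%:R.
Hypothesis DE : forall p, U p -> D p =
  [set x | [/\ pair (w i_z p) x = 0, pair (w i_theta p) x = 0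
             & pair (w i_phi p) x = 0]].
Hypothesis streq : cartan_equations U (w i_z) (w i_theta) (w i_phi) (w i_x)
  (w i_q) o1 o2 o3 o4 o5 o6 o7.
Implicit Types (p x y : 'rV[R]_5) (X Y : 'rV[R]_5 -> 'rV[R]_5).

Let dw i p : U p -> differentiable_row (w i) p.
Proof. by move=> Up j; exact: (elem_differentiable oU (ew i j)). Qed.

Let de i p : U p -> differentiable_row (e i) p.
Proof. by move=> Up j; exact: (elem_differentiable oU (ee i j)). Qed.

Let smooth_diff (V : set 'rV[R]_5) X p : smooth_mx_on V X -> V p ->
  differentiable_row X p.
Proof. by move=> sX Vp j; have [dX _] := sX 0 j 1%N; exact: dX. Qed.

(* On vector fields with constant pairings with w, only the last term of
   Cartan's formula survives. *)
Let pair_bracket i X Y p V (c c' : R) : open V -> V p -> U p ->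
  differentiable_row X p -> differentiable_row Y p ->
  (forall q, V q -> pair (w i q) (X q) = c) ->
  (forall q, V q -> pair (w i q) (Y q) = c') ->
  pair (w i p) (lie_bracket X Y p) = - form2 (ext_deriv (w i) p) (X p) (Y p).
Proof.
move=> oV Vp Up dX dY Xc Yc'; rewrite (cartan_formula (dw i Up) dX dY).
rewrite !big1 ?subrr ?sub0r// => j _.
  by rewrite (partial_eq_on j oV Vp Xc) partial_cst mulr0.
by rewrite (partial_eq_on j oV Vp Yc') partial_cst mulr0.
Qed.

(** The names [i_z], ..., [i_q] only number theta_1, ..., theta_5 and the dual vectors e_1, ..., e_5
    here: D is spanned by e_4, e_5, and [D, D] will be spanned by e_3, e_4, e_5. *)
Let s2 (i : 'I_2) : 'I_5 := nth i_z [:: i_x; i_q] i.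
Let s3 (i : 'I_3) : 'I_5 := nth i_z [:: i_phi; i_x; i_q] i.

Let span2 p x : U p -> D p x <-> x \in <<[tuple e (s2 i) p | i < 2]>>%VS.
Proof.
move=> Up; rewrite (DE Up).
have := dual_span (fun i j => we i j Up) s2 x => H; split.
  move=> [x1 x2 x3]; apply/H; elim/ord5P => // sj.
    by have := sj ord0; rewrite eqxx.
  by have := sj ord_max; rewrite eqxx.
by move=> /H{}H; split; apply: H => -[[|[|//]] ?].
Qed.

Definition rank3 p : {vspace 'rV[R]_5} := <<[tuple e (s3 i) p | i < 3]>>%VS.

Let span3 p x : U p -> x \in rank3 p <->
  pair (w i_z p) x = 0 /\ pair (w i_theta p) x = 0.
Proof.
move=> Up; have := dual_span (fun i j => we i j Up) s3 x => H; split.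
  by move=> /H{}H; split; apply: H => -[[|[|[|//]]] ?].
move=> [x1 x2]; apply/H; elim/ord5P => // sj.
- by have := sj ord0; rewrite eqxx.
- by have := sj (Ordinal (isT : (1 < 3)%N)); rewrite eqxx.
- by have := sj ord_max; rewrite eqxx.
Qed.

Let De p i : U p -> i = i_x \/ i = i_q -> D p (e i p).
Proof. by move=> Up [->|->]; rewrite (DE Up); split; rewrite we. Qed.

(** In Cartan's equations every term of d theta_1 and d theta_2 contains theta_1, theta_2 or
    theta_3, so both 2-forms vanish on pairs of vectors of D and brackets of sections are killed by
    theta_1 and theta_2. *)
Let bracket_sub p x : U p -> bracket_dist U D D p x -> x \in rank3 p.
Proof.
move=> Up; apply=> y [V [X [Y [[oV Vp VU] [sX DX] [sY DY] ->]]]].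
have dX := smooth_diff sX Vp; have dY := smooth_diff sY Vp.
have zX q : V q -> [/\ pair (w i_z q) (X q) = 0, pair (w i_theta q) (X q) = 0
    & pair (w i_phi q) (X q) = 0].
  by move=> Vq; have := DX q Vq; rewrite DE//; exact: VU.
have zY q : V q -> [/\ pair (w i_z q) (Y q) = 0, pair (w i_theta q) (Y q) = 0
    & pair (w i_phi q) (Y q) = 0].
  by move=> Vq; have := DY q Vq; rewrite DE//; exact: VU.
have [x1 x2 x3] := zX p Vp; have [y1 y2 y3] := zY p Vp.
have [d1 d2 _ _ _] := streq Up.
apply/(span3 _ Up); split.
  rewrite (pair_bracket oV Vp Up dX dY (c := 0) (c' := 0)) => [|q /zX[]//|q /zY[]//].
  by rewrite d1 form2_wedge3 x1 x2 x3 y1 y2 y3; ring.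
rewrite (pair_bracket oV Vp Up dX dY (c := 0) (c' := 0)) => [|q /zX[]//|q /zY[]//].
by rewrite d2 form2_wedge3 x1 x2 x3 y1 y2 y3; ring.
Qed.

Let frame_bracket p i j l : U p ->
  pair (w l p) (lie_bracket (e i) (e j) p) = - form2 (ext_deriv (w l) p) (e i p) (e j p).
Proof.
move=> Up; apply: (pair_bracket oU Up Up (de i Up) (de j Up)) => q Uq;
  exact: we.
Qed.

(* [e4, f e5] = f [e4, e5] + e4(f) e5 with f(p) = 0 and e4(f) = 1. *)
Let frame_mem p i j (W : {vspace 'rV[R]_5}) (E : 'rV[R]_5 -> set 'rV[R]_5) :
  U p -> i = i_x \/ i = i_q -> j = i_x \/ j = i_q ->
  (forall q, U q -> E q (e i q)) ->
  (forall v, (exists V X Y, [/\ open_nbhd_in U p V, is_section V E X,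
     is_section V D Y & v = lie_bracket X Y p]) -> v \in W) -> e j p \in W.
Proof.
(* [bracket_dist] contains brackets only, so D has to be recovered from them. This affine function
   vanishes at p and has differential [w i p] there, so its derivative along [e i] at p is 1. *)
move=> Up hi hj Ee memW; pose f q := pair (w i p) (q - p).
have ef : elem U f.
  apply: elem_sum => k; apply: elemM; first exact: elem_cst.
  apply: elem_eq (elemB (elem_coord U k) (elem_cst U (p 0 k))) => q _.
  by rewrite !mxE.
have pf l : partial l f p = w i p 0 l.
  have dc (c : R) : differentiable (fun=> c : R) p by exact: differentiable_cst.
  have fE k : (fun q : 'rV[R]_5 => w i p 0 k * (q - p) 0 k) =
      fun q => w i p 0 k * (q 0 k - p 0 k).
    by apply/funext => q; rewrite !mxE.
  have dk k : differentiable (fun q : 'rV[R]_5 => q 0 k - p 0 k) p.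
    exact: (differentiableB (differentiable_coord _ _ _) (dc _)).
  rewrite partial_sum => [|k _]; last first.
    by rewrite fE; apply: differentiableM.
  transitivity (\sum_k w i p 0 k * (l == k)%:R).
    apply: eq_bigr => k _; rewrite fE partialM// partialB//; last first.
      exact: differentiable_coord.
    by rewrite !partial_cst partial_coord mul0r add0r subr0.
  rewrite (bigD1 l)//= eqxx mulr1 big1 ?addr0// => k kl.
  by rewrite eq_sym (negbTE kl) mulr0.
have Ufe : is_section U D (fun q => f q *: e j q).
  split; first by apply: (elem_row_smooth oU); apply: elem_rowZ.
  move=> q Uq; have := De Uq hj; rewrite (DE Uq) => -[a1 a2 a3].
  by split; rewrite pairZr ?a1 ?a2 ?a3 mulr0.
have : lie_bracket (e i) (fun q => f q *: e j q) p \in W.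
  apply: memW; exists U, (e i), (fun q => f q *: e j q).
  by split=> //; split=> //; exact: (elem_row_smooth oU).
rewrite (lie_bracketZr (e i) (elem_differentiable oU ef Up) (de j Up)).
have -> : f p = 0 by rewrite /f subrr pairC pair0l.
under eq_bigr do rewrite pf mulrC.
by rewrite scale0r add0r -/(pair _ _) we// eqxx scale1r.
Qed.


Let open_U p : U p -> open_nbhd_in U p U.
Proof. by split. Qed.

Let sec_e i : smooth_mx_on U (e i).
Proof. exact: elem_row_smooth. Qed.

Let secD i : i = i_x \/ i = i_q -> is_section U D (e i).
Proof. by move=> hi; split=> // q Uq; exact: De. Qed.

(** The term theta_4 wedge theta_5 occurs in d theta_3 and in neither d theta_1 nor d theta_2, so
    [e_4, e_5] is - e_3 modulo D. *)
Let bracket45 p : U p -> exists a b,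
  e i_phi p = - lie_bracket (e i_x) (e i_q) p + a *: e i_x p + b *: e i_q p.
Proof.
move=> Up; have [d1 d2 d3 _ _] := streq Up.
set x := lie_bracket _ _ _.
have x1 : pair (w i_z p) x = 0.
  by rewrite frame_bracket// d1 form2_wedge3 !we//=; ring.
have x2 : pair (w i_theta p) x = 0.
  by rewrite frame_bracket// d2 form2_wedge3 !we//=; ring.
have x3 : pair (w i_phi p) x = -1.
  by rewrite frame_bracket// d3 form2_wedge4 !we//=; ring.
exists (pair (w i_x p) x), (pair (w i_q p) x).
rewrite {1}(dual_expand (fun i j => we i j Up) x) sum_ord5 x1 x2 x3.
by rewrite !scale0r !add0r scaleN1r -!addrA opprD opprK subrK.
Qed.

(** The terms theta_3 wedge theta_4 in d theta_1 and theta_3 wedge theta_5 in d theta_2 make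
    [e_3, e_4] and [e_3, e_5] equal to - e_1 and - e_2 modulo e_3, e_4, e_5. *)
Let bracket3 p j : U p -> j = i_x \/ j = i_q -> exists a b c,
  e (if j == i_x then i_z else i_theta) p =
  - lie_bracket (e i_phi) (e j) p + a *: e i_phi p + b *: e i_x p + c *: e i_q p.
Proof.
move=> Up hj; have [d1 d2 _ _ _] := streq Up.
set x := lie_bracket _ _ _.
have x1 : pair (w i_z p) x = - (j == i_x)%:R.
  rewrite frame_bracket// d1 form2_wedge3 !we//=.
  by case: hj => ->; rewrite /=; ring.
have x2 : pair (w i_theta p) x = - (j == i_q)%:R.
  rewrite frame_bracket// d2 form2_wedge3 !we//=.
  by case: hj => ->; rewrite /=; ring.
exists (pair (w i_phi p) x), (pair (w i_x p) x), (pair (w i_q p) x).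
rewrite {1}(dual_expand (fun i j => we i j Up) x) sum_ord5 x1 x2.
by case: hj => ->; rewrite /= oppr0 scale0r ?addr0 ?add0r scaleN1r -!addrA
  opprD opprK subrK.
Qed.

Lemma bracket_dist_rank3 p : U p ->
  bracket_dist U D D p = [set x | x \in rank3 p].
Proof.
move=> Up; apply/seteqP; split=> [x|x]; first exact: bracket_sub.
move=> x3 W memW.
have m4 : e i_x p \in W.
  apply: (@frame_mem p i_x i_x W D) => //; [by left|by left|].
  by move=> q Uq; apply: De => //; left.
have m5 : e i_q p \in W.
  apply: (@frame_mem p i_q i_q W D) => //; [by right|by right|].
  by move=> q Uq; apply: De => //; right.
have m45 : lie_bracket (e i_x) (e i_q) p \in W.
  apply: memW; exists U, (e i_x), (e i_q); split=> //; first exact: open_U.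
    by apply: secD; left.
  by apply: secD; right.
have m3 : e i_phi p \in W.
  by have [a [b ->]] := bracket45 Up; rewrite !memvD ?memvN ?memvZ.
move: x3; rewrite /= /rank3 => /coord_span ->; apply: memv_suml => i _.
apply: memvZ; rewrite nth_mktuple.
by case: i => [[|[|[|//]]] ?].
Qed.

Lemma distribution235_of_cartan : distribution235 U D.
Proof.
split.
- move=> p Up; exists U; split; first exact: open_U.
  exists (fun i => e (s2 i)); split; first by move=> i; exact: sec_e.
  move=> q Uq B; split.
    apply: (dual_free (x := fun i => w (s2 i) q)) => i j; rewrite pairC we//.
    by case: i => [[|[|//]] ?]; case: j => [[|[|//]] ?].
  by apply/seteqP; split=> x /span2; apply.
- move=> p Up; exists (rank3 p); split; last exact: bracket_dist_rank3.
  suff /eqP -> : free [tuple e (s3 i) p | i < 3] by rewrite size_tuple.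
  apply: (dual_free (x := fun i => w (s3 i) p)) => i j; rewrite pairC we//.
  by case: i => [[|[|[|//]]] ?]; case: j => [[|[|[|//]]] ?].
- move=> p Up; apply/seteqP; split=> // x _ W memW.
  have E q i : U q -> i = i_phi \/ i = i_x \/ i = i_q ->
      bracket_dist U D D q (e i q).
    by move=> Uq hi; rewrite bracket_dist_rank3//; apply/span3 => //;
      case: hi => [|[]] ->; rewrite !we.
  have sE i : i = i_phi \/ i = i_x \/ i = i_q -> is_section U (bracket_dist U D D) (e i).
    by move=> hi; split=> // q Uq; exact: E.
  have m4 : e i_x p \in W.
    apply: (@frame_mem p i_x i_x W _ Up _ _ _ memW); [by left|by left|].
    by move=> q Uq; apply: E => //; right; left.
  have m5 : e i_q p \in W.
    apply: (@frame_mem p i_q i_q W _ Up _ _ _ memW); [by right|by right|].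
    by move=> q Uq; apply: E => //; right; right.
  have br i j : i = i_phi \/ i = i_x \/ i = i_q -> j = i_x \/ j = i_q ->
      lie_bracket (e i) (e j) p \in W.
    move=> hi hj; apply: memW; exists U, (e i), (e j).
    by split=> //; [exact: open_U|exact: sE|exact: secD].
  have m3 : e i_phi p \in W.
    have [a [b ->]] := bracket45 Up; rewrite !memvD ?memvN ?memvZ//.
    by apply: br; [right; left|right].
  have m12 j : j = i_x \/ j = i_q -> e (if j == i_x then i_z else i_theta) p \in W.
    move=> hj; have [a [b [c ->]]] := bracket3 Up hj.
    by rewrite !memvD ?memvN ?memvZ// br//; left.
  rewrite (dual_expand (fun i j => we i j Up) x) sum_ord5.
  by rewrite !memvD ?memvZ//; [apply: (m12 i_x); left|apply: (m12 i_q); right].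
Qed.

End Distribution235.

(** * The substitution exchanging the two spheres *)

Section Jacobian.
Context {R : realType} {m n : nat}.
Implicit Types F : 'rV[R]_m -> 'rV[R]_n.

Lemma differentiable_rowP F p :
  (forall k, differentiable (fun q => F q 0 k) p) -> differentiable F p.
Proof.
move=> dF; rewrite (_ : F = \sum_k (fun q => F q 0 k *: delta_mx 0 k)).
  by apply: differentiable_sum => k; exact: differentiableZl.
apply/funext => q; rewrite fct_sumE; exact: row_sum_delta.
Qed.

Lemma jacobianE F p i k : (forall k, differentiable (fun q => F q 0 k) p) ->
  'J F p i k = partial i (fun q => F q 0 k) p.
Proof.
move=> dF; have dF' := differentiable_rowP dF.
have dk : differentiable (fun x : 'rV[R]_n => x 0 k) (F p).
  exact: differentiable_coord.
pose c (x : 'rV[R]_n) : R := x 0 k.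
have c_lin : linear c by move=> a u v; rewrite /c !mxE.
pose cM := GRing.isLinear.Build _ _ _ _ _ c_lin.
pose cL : {linear _ -> _} := HB.pack c cM.
rewrite /partial deriveE; last exact: (differentiable_comp dF' dk).
rewrite (diff_comp dF' dk) /= (_ : 'd (fun x : 'rV[R]_n => x 0 k) _ = cL :> (_ -> _)).
  by rewrite /cL /= /c -mul_rV_lin1 -rowE [RHS]mxE.
by apply: (@diff_lin _ _ _ cL); exact: coord_continuous.
Qed.

End Jacobian.

Section Swap.
Context {R : realType}.
Implicit Types p : 'rV[R]_5.

Lemma elem_swap (U : set 'rV[R]_5) : elem_row U (@swap_map R).
Proof.
move=> k; have ec i := elem_coord U i.
elim/ord5P: k; [move: (elemN (ec i_z))|move: (ec i_x)|move: (ec i_q)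
  |move: (ec i_theta)|move: (ec i_phi)]; by apply: elem_eq => p _; rewrite mxE.
Qed.

Lemma swap_mapK p : swap_map (swap_map p) = p.
Proof.
by apply/rowP; elim/ord5P;
  rewrite /swap_map !mxE /= /cz /ctheta /cphi /cx /cq !mxE ?opprK.
Qed.

Lemma swap_M5 p : M5 p -> M5 (swap_map p).
Proof. by move=> [st sx]; split; rewrite /ctheta /cx mxE. Qed.

(** The Jacobian of [swap_map] is a signed permutation matrix; pulling back therefore only permutes
    entries and changes signs. *)
Definition swap_sign (i : 'I_5) : R := if i == i_z then -1 else 1.
Definition swap_index (i : 'I_5) : 'I_5 := nth i_z [:: i_z; i_x; i_q; i_theta; i_phi] i.

Lemma jacobian_swap p i k :
  'J swap_map p i k = swap_sign i * (k == swap_index i)%:R.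
Proof.
rewrite jacobianE => [|l]; last first.
  exact: (elem_differentiable openT (elem_swap setT l) I).
have dN l : differentiable (fun q : 'rV[R]_5 => q 0 l) p.
  exact: differentiable_coord.
have E0 : (fun q : 'rV[R]_5 => swap_map q 0 i_z) = fun q => - q 0 i_z.
  by apply/funext => q; rewrite mxE.
have E1 : (fun q : 'rV[R]_5 => swap_map q 0 i_theta) = fun q => q 0 i_x.
  by apply/funext => q; rewrite mxE.
have E2 : (fun q : 'rV[R]_5 => swap_map q 0 i_phi) = fun q => q 0 i_q.
  by apply/funext => q; rewrite mxE.
have E3 : (fun q : 'rV[R]_5 => swap_map q 0 i_x) = fun q => q 0 i_theta.
  by apply/funext => q; rewrite mxE.
have E4 : (fun q : 'rV[R]_5 => swap_map q 0 i_q) = fun q => q 0 i_phi.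
  by apply/funext => q; rewrite mxE.
elim/ord5P: k; rewrite ?E0 ?E1 ?E2 ?E3 ?E4 ?partialN// partial_coord;
  elim/ord5P: i; rewrite /swap_sign /swap_index /= ?mulr0 ?mulr1 ?oppr0 //.
Qed.

Lemma pullback_swap (g : 'rV[R]_5 -> 'M[R]_5) p i j :
  pullback swap_map g p i j = swap_sign i * swap_sign j *
    g (swap_map p) (swap_index i) (swap_index j).
Proof.
have pick (F : 'I_5 -> R) l : \sum_k F k * (k == l)%:R = F l.
  rewrite (bigD1 l)//= eqxx mulr1 big1 ?addr0// => k kl.
  by rewrite (negbTE kl) mulr0.
rewrite /pullback mxE; under eq_bigr do rewrite [X in _ * X]mxE jacobian_swap mulrA.
rewrite pick mxE; under eq_bigr do rewrite jacobian_swap mulrAC.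
by rewrite pick; ring.
Qed.

(** For the parameter eps, [eta1] is e^(iz) (d theta - i sin theta d phi) + eps (dx - i sin x dq).
    The substitution multiplies it by eps e^(-iz) and changes the sign of [eta3], so the square part
    is preserved while the two spheres are exchanged. *)
Lemma cone_metric_swap eps p : eps ^+ 2 = 1 ->
  pullback swap_map (cone_metric true eps) p = cone_metric false eps p.
Proof.
move=> e2; apply/matrixP => i j; rewrite pullback_swap.
have hz : cos (cz p) ^+ 2 = 1 - sin (cz p) ^+ 2.
  by rewrite -(cos2Dsin2 (cz p)) addrK.
rewrite !cone_metricE !pfaffAE !pfaffBE !pfaffEE.
have -> : cz (swap_map p) = - cz p by rewrite /cz mxE.
have -> : ctheta (swap_map p) = cx p by rewrite /ctheta mxE.
have -> : cx (swap_map p) = ctheta p by rewrite /cx mxE.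
rewrite cosN sinN; elim/ord5P: i; elim/ord5P: j; rewrite /swap_sign /swap_index /=.
all: by ring: hz e2.
Qed.

End Swap.

(** * Independence of the complex Pfaffian forms *)

Section EtaForms.
Context {R : realType}.
Implicit Types (alpha : R) (p : 'rV[R]_5).

Lemma eta2_conj alpha p : eta2 alpha p = map_mx (@conjc R) (eta1 alpha p).
Proof.
rewrite eta1_real eta2_real; move: (pfaffA alpha p) (pfaffB alpha p) => a b.
apply/rowP => i; rewrite !mxE; apply/eqP; rewrite eq_complex /=.
by rewrite !(mul0r, mul1r, mulr0, subr0, addr0, add0r, oppr0) !eqxx.
Qed.

Lemma pair_toC (a b : 'rV[R]_5) : pair (toC a) (toC b) = (pair a b)%:C%C.
Proof.
rewrite /pair rmorph_sum; apply: eq_bigr => i _.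
by rewrite !mxE rmorphM.
Qed.

Lemma eta_free alpha p : M5 p ->
  free [:: eta1 alpha p; eta2 alpha p; eta3 p].
Proof.
move=> Mp; have b i j := bcofr_bfr alpha i j Mp.
rewrite eta1_real eta2_real eta3_real.
pose a1 := toC (frA p); pose a2 := toC (frB p).
pose w (i : 'I_3) : 'rV[R[i]]_5 :=
  [:: toC (pfaffA alpha p) + 'i%C *: toC (pfaffB alpha p);
      toC (pfaffA alpha p) - 'i%C *: toC (pfaffB alpha p); toC (pfaffE p)]`_i.
(* Dual vectors in the manner of Wirtinger derivatives: half of A - i B and of A + i B for the real
   dual vectors A and B. *)
pose x (i : 'I_3) : 'rV[R[i]]_5 :=
  [:: 2^-1 *: (a1 - 'i%C *: a2); 2^-1 *: (a1 + 'i%C *: a2); toC (frE p)]`_i.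
suff wx : forall i j, pair (w i) (x j) = (i == j)%:R.
  have := dual_free wx; congr (is_true (free _)).
  apply: (@eq_from_nth _ 0) => [|i]; first by rewrite size_tuple.
  rewrite size_tuple => i3; have -> : i = Ordinal i3 by [].
  by rewrite nth_mktuple.
have C i j : pair (toC (bcofr alpha p i)) (toC (bfr alpha p j)) = (i == j)%:R.
  by rewrite pair_toC b rmorph_nat.
have := C i_z i_z; have := C i_z i_theta; have := C i_z i_phi.
have := C i_theta i_z; have := C i_theta i_theta; have := C i_theta i_phi.
have := C i_phi i_z; have := C i_phi i_theta; have := C i_phi i_phi.
rewrite /bcofr /bfr /= -/a1 -/a2 /w /x {C w x b}.
move: a1 a2 (toC (frE p)) => a1 a2 a3.
move: (toC (pfaffA alpha p)) (toC (pfaffB alpha p)) (toC (pfaffE p)) => w1 w2 w3.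
move=> c33 c32 c31 c23 c22 c21 c13 c12 c11 i j.
have hi : ('i%C : R[i]) ^+ 2 = -1 := sqr_i R.
move: ('i%C : R[i]) hi => I hi.
case: i => [[|[|[|//]]] ?]; case: j => [[|[|[|//]]] ?] /=;
  rewrite ?(pairDl, pairZl, pairDr, pairZr, pairNl, pairNr)
    ?c11 ?c12 ?c13 ?c21 ?c22 ?c23 ?c31 ?c32 ?c33; by field: hi.
Qed.

End EtaForms.

(** * The four parameter values and the resulting distributions and metrics *)

Section Main.
Context {R : realType}.
Implicit Types (alpha : R) (b : bool).

Lemma third_alphaP alpha : alpha = 3^-1 \/ alpha = - 3^-1 ->
  exists eps, eps ^+ 2 = 1 /\ alpha = eps / 3.
Proof.
by case=> ->; [exists 1; rewrite expr1n mul1r|exists (-1); rewrite sqrrN expr1n mulN1r].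
Qed.

Lemma three_alphaP alpha : alpha = 3 \/ alpha = - 3 ->
  exists eps, eps ^+ 2 = 1 /\ alpha = eps * 3.
Proof.
by case=> ->; [exists 1; rewrite expr1n mul1r|exists (-1); rewrite sqrrN expr1n mulN1r].
Qed.

Lemma metric_thirdE eps : eps ^+ 2 = 1 ->
  metric_third (eps / 3) = cone_metric true eps :> ('rV[R]_5 -> _).
Proof. by move=> e2; apply/funext => p; exact: metric_third_cone. Qed.

Lemma metric_threeE eps : eps ^+ 2 = 1 ->
  metric_three (eps * 3) = cone_metric false eps :> ('rV[R]_5 -> _).
Proof. by move=> e2; apply/funext => p; exact: metric_three_cone. Qed.

Lemma sqr_alphaP alpha : alpha ^+ 2 = 9^-1 \/ alpha ^+ 2 = 9 <->
  (alpha = 3^-1 \/ alpha = - 3^-1) \/ (alpha = 3 \/ alpha = - 3).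
Proof.
have H (c : R) : alpha ^+ 2 = c ^+ 2 <-> alpha = c \/ alpha = - c.
  split=> [/eqP|[->|->]]; [|by []|exact: sqrrN].
  by rewrite eqf_sqr => /orP[]/eqP->; [left|right].
have -> : 9 = 3 ^+ 2 :> R by ring.
by rewrite -exprVn !H.
Qed.

Lemma pfaff_distribution b (eps : R) : eps ^+ 2 = 1 ->
  distribution235 M5 (pfaff_kernel (par_alpha b eps)).
Proof.
move=> e2.
apply: (@distribution235_of_cartan _ M5 _
  (fun i p => cofr (par_alpha b eps) (par_k b) (par_lam b) (par_u b) (par_v b eps) p i)
  (fun i p => fr (par_alpha b eps) (par_k b) (par_lam b) (par_u b) (par_v b eps) p i)).
- exact: M5_open.
- by move=> i; exact: elem_cofr.
- by move=> i; exact: elem_fr.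
- move=> p i j Mp.
  by apply: cofr_fr => //; [exact: par_k0|exact: par_lam0|exact: par_v0].
- by move=> p _; exact: par_kernel.
- exact: (cofr_cartan e2 (parP b eps)).
Qed.

Lemma pfaff_maximally_symmetric b (eps : R) : eps ^+ 2 = 1 ->
  maximally_symmetric M5 (pfaff_kernel (par_alpha b eps)).
Proof.
move=> e2 p Mp; exists M5, (cone_metric b eps); split.
- by split=> //; exact: M5_open.
- exact: cone_in_nurowski_class.
- exact: cone_weyl_vanishes.
Qed.

Lemma swap_isometry (eps a c : R) : eps ^+ 2 = 1 -> a = eps * 3 -> c = eps / 3 ->
  is_isometry M5 (metric_three a) M5 (metric_third c) swap_map.
Proof.
move=> e2 -> ->; rewrite metric_threeE// metric_thirdE//.
split; last by move=> p _; exact: cone_metric_swap.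
have sm : smooth_mx_on M5 (@swap_map R).
  exact: (elem_row_smooth M5_open (elem_swap M5)).
by exists swap_map; split=> // p Mp; split; [exact: swap_M5|exact: swap_mapK
  |exact: swap_M5|exact: swap_mapK].
Qed.

End Main.
Theorem theorem6p1 (R : realType) :
  (forall (alpha : R) (p : 'rV[R]_5), M5 p ->
     [/\ eta2 alpha p = map_mx (@conjc R) (eta1 alpha p),
         free [:: eta1 alpha p; eta2 alpha p; eta3 p],
         toC (metric_third alpha p) = metric_thirdC alpha p
       & toC (metric_three alpha p) = metric_threeC alpha p]) /\
  (forall alpha : R,
     (alpha ^+ 2 = 9^-1 \/ alpha ^+ 2 = 9 <->
      (alpha = 3^-1 \/ alpha = - 3^-1) \/ (alpha = 3 \/ alpha = - 3)) /\
     (alpha ^+ 2 = 9^-1 \/ alpha ^+ 2 = 9 ->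
      distribution235 M5 (pfaff_kernel alpha) /\
      maximally_symmetric M5 (pfaff_kernel alpha))) /\
  (forall alpha : R, alpha = 3^-1 \/ alpha = - 3^-1 ->
     [/\ in_nurowski_class M5 (pfaff_kernel alpha) (metric_third alpha),
         conformally_flat M5 (metric_third alpha),
         weyl_vanishes M5 (metric_third alpha)
       & forall p, M5 p -> cos (ctheta p) != 0 ->
           ricci (metric_third_hat alpha) p
           = 12^-1 *: metric_third_hat alpha p]) /\
  (forall alpha : R, alpha = 3 \/ alpha = - 3 ->
     [/\ in_nurowski_class M5 (pfaff_kernel alpha) (metric_three alpha),
         conformally_flat M5 (metric_three alpha),
         weyl_vanishes M5 (metric_three alpha)
       & forall p, M5 p -> cos (cx p) != 0 ->
           ricci (metric_three_hat alpha) p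
           = 12^-1 *: metric_three_hat alpha p]) /\
  (is_isometry M5 (metric_three (3 : R)) M5 (metric_third (3^-1 : R)) swap_map /\
   is_isometry M5 (metric_three (- 3 : R)) M5 (metric_third (- 3^-1 : R))
     swap_map).
Proof.
split.
  move=> alpha p Mp; split; [exact: eta2_conj|exact: eta_free| |].
    by rewrite /metric_third metric_thirdC_real toC_Re.
  by rewrite /metric_three metric_threeC_real toC_Re.
split.
  move=> alpha; split; first exact: sqr_alphaP.
  move=> /sqr_alphaP[/third_alphaP|/three_alphaP] [eps [e2 ->]].
    by split; [exact: (pfaff_distribution true)
              |exact: (pfaff_maximally_symmetric true)].
  by split; [exact: (pfaff_distribution false)
            |exact: (pfaff_maximally_symmetric false)].
split.
  move=> alpha /third_alphaP[eps [e2 ->]]; rewrite /metric_third_hat metric_thirdE//.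
  split; [exact: (cone_in_nurowski_class true)|exact: cone_conformally_flat
         |exact: cone_weyl_vanishes|move=> p Mp cp; exact: (cone_einstein (b := true))].
split.
  move=> alpha /three_alphaP[eps [e2 ->]]; rewrite /metric_three_hat metric_threeE//.
  split; [exact: (cone_in_nurowski_class false)|exact: cone_conformally_flat
         |exact: cone_weyl_vanishes|move=> p Mp cp; exact: (cone_einstein (b := false))].
have e1 : 1 ^+ 2 = 1 :> R by rewrite expr1n.
have eN1 : (-1) ^+ 2 = 1 :> R by rewrite sqrrN.
split; first by apply: (swap_isometry e1); rewrite mul1r.
by apply: (swap_isometry eN1); rewrite mulN1r.
Qed.
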